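(* Let $K$ be a connected compact semisimple Lie group, $V$ a finite-dimensional unitary representation of $K$ with set of weights $\Lambda(V)$, and $\mu:\mathbb P(V)\to\mathfrak k^*$ the momentum map. Let $\Xi=\{\xi_M: M\subset\Lambda(V),\ M\neq\emptyset\}$, where $\xi_M$ is the point of the convex hull of $M$ closest to the origin. If $\xi\in\Xi$ is regular, then the set $C_\xi$ of critical points of $\|\mu\|^2$ contained in $\mu^{-1}(\xi)$ is nonempty, i.e. $\xi$ is an intermediate critical value of $\|\mu\|^2$.
   Context: $T\subset K$ is a maximal torus with Lie algebra $\mathfrak t$; weights are regarded as elements of the real vector space $\mathfrak t^*$ (as differentials divided by $i$), with the Weyl-group-invariant inner product induced by the Killing form; distances in $\mathfrak t^*$ and $\mathfrak k^*$ are with respect to the (sign-normalized) Killing form. $\mathfrak t^*$ is identified with $\mathfrak t$ and embedded in $\mathfrak k^*$ via the Killing form. The momentum map is $\mu[v](\eta)=\frac1i\frac{\langle\eta v,v\rangle}{\langle v,v\rangle}$ for $[v]\in\mathbb P(V)$, $\eta\in\mathfrak k$, where $\langle\cdot,\cdot\rangle$ is the $K$-invariant Hermitian form. An element $\xi\in\mathfrak t^*$ is regular if it lies in the interior of a Weyl chamber, i.e. $(\xi|\alpha)\ne0$ for all roots $\alpha$. An element $\xi\in\mathfrak t^*$ is called an intermediate critical value of $\|\mu\|^2$ if $\mu^{-1}(\xi)$ contains critical points of the function $\|\mu\|^2:\mathbb P(V)\to\mathbb R$. *)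

(* Defs.v *)
From HB Require Import structures.
From mathcomp Require Import all_boot all_order all_algebra.
From mathcomp Require Import complex.
From mathcomp Require Import all_classical all_reals all_analysis.

Set Implicit Arguments.
Unset Strict Implicit.
Unset Printing Implicit Defensive.

Import Order.TTheory GRing.Theory Num.Theory.
Import numFieldNormedType.Exports.

Local Open Scope classical_set_scope.
Local Open Scope ring_scope.

HB.mixin Record isTopologicalGroup G of Topological G & Group G := {
  mulg_continuous : continuous (fun z : G * G => (z.1 * z.2)%g) ;
  invg_continuous : continuous (fun x : G => (x^-1)%g)
}.

#[short(type="topologicalGroupType")]
HB.structure Definition TopologicalGroup :=
  {G of Topological G & Group G & isTopologicalGroup G}.

(* [Ck n D f]: for D open, f is of class C^n on D. *)
Fixpoint Ck (R : realType) (U W : normedModType R) (n : nat)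
    (D : set U) (f : U -> W) : Prop :=
  match n with
  | 0 => forall x, D x -> {for x, continuous f}
  | n'.+1 => (forall x, D x -> differentiable f x) /\
             (forall v : U, Ck n' D ('D_v f))
  end.

Definition smooth_on (R : realType) (U W : normedModType R)
    (D : set U) (f : U -> W) : Prop :=
  forall n, Ck n D f.

Section LieGroups.
Variables (R : realType) (d : nat).

(* [coord] is meaningful on [cdom] only, and its inverse [param] on
   [coord @` cdom] only. *)
Record chart (G : topologicalType) := Chart {
  cdom : set G ;
  coord : G -> 'rV[R]_d ;
  param : 'rV[R]_d -> G ;
  cdom_open : open cdom ;
  crange_open : open (coord @` cdom) ;
  coordK : forall x, cdom x -> param (coord x) = x ;
  coord_continuous : forall x, cdom x -> {for x, continuous coord} ;
  param_continuous :
    forall y, (coord @` cdom) y -> {for y, continuous param}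
}.

Definition crange (G : topologicalType) (c : chart G) : set 'rV[R]_d :=
  coord c @` cdom c.

Record lieGroup (G : topologicalGroupType) := LieGroup {
  atlas : set (chart G) ;
  lie_hausdorff : hausdorff_space G ;
  atlas_cover : forall x : G, exists2 c, atlas c & cdom c x ;
  atlas_compat : forall a b, atlas a -> atlas b ->
    smooth_on (crange a `&` (param a @^-1` cdom b)) (coord b \o param a) ;
  mulg_smooth : forall a b c, atlas a -> atlas b -> atlas c ->
    smooth_on
      [set z : 'rV[R]_d * 'rV[R]_d |
        [/\ crange a z.1, crange b z.2
          & cdom c (param a z.1 * param b z.2)%g]]
      (fun z => coord c (param a z.1 * param b z.2)%g) ;
  invg_smooth : forall a b, atlas a -> atlas b ->
    smooth_on (crange a `&` [set x | cdom b (param a x)^-1%g])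
      (fun x => coord b (param a x)^-1%g)
}.

(* The Lie algebra k of G is the tangent space at the identity, which a chart
   [c] of G around the identity identifies with 'rV[R]_d; [c] is a parameter
   of everything below. *)
Section LieAlgebra.
Variables (G : topologicalGroupType) (c : chart G).

Local Notation p1 := (coord c 1%g).

(* Matrices act on row vectors: Ad(g)(x) is [x *m Ad g], and
   [x, y] = ad(x)(y) is [y *m ad x], where ad is the derivative of Ad at the
   identity. *)
Definition Ad (g : G) : 'M[R]_d :=
  'J (fun x => coord c (g * param c x * g^-1)%g) p1.

Definition ad (x : 'rV[R]_d) : 'M[R]_d :=
  'D_x (fun y => Ad (param c y)) p1.

Definition killing (x y : 'rV[R]_d) : R := \tr (ad x *m ad y).

Definition semisimple : Prop :=
  forall x, (forall y, killing x y = 0) -> x = 0.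

(* Sign-normalized Killing form: positive definite for G compact and
   semisimple. *)
Definition kform (x y : 'rV[R]_d) : R := - killing x y.

Definition kgram : 'M[R]_d :=
  \matrix_(i, j) kform (delta_mx 0 i) (delta_mx 0 j).

(* An element f of the dual k^* is represented by the row vector of its values
   on the standard basis of k, i.e. f(x) = \sum_i f 0 i * x 0 i.
   [flat] and [sharp] are the identifications k -> k^* and k^* -> k induced by
   [kform]. *)
Definition flat (x : 'rV[R]_d) : 'rV[R]_d := x *m kgram.
Definition sharp (f : 'rV[R]_d) : 'rV[R]_d := f *m invmx kgram.
Definition pairing (f x : 'rV[R]_d) : R := \sum_(i < d) f 0 i * x 0 i.

Definition dual_form (f g : 'rV[R]_d) : R := kform (sharp f) (sharp g).

Definition normsq (f : 'rV[R]_d) : R := dual_form f f.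

(* For compact G the compact subgroups are the compact Lie subgroups, and a
   torus is a compact connected abelian one. *)
Definition torus (T : set G) : Prop :=
  [/\ T 1%g,
      forall g h, T g -> T h -> T (g * h^-1)%g,
      forall g h, T g -> T h -> (g * h = h * g)%g,
      compact T & connected T].

Definition maximal_torus (T : set G) : Prop :=
  torus T /\ forall S, torus S -> T `<=` S -> S = T.

Section Torus.
Variable T : set G.

(* [gamma] is the one-parameter subgroup s |-> exp(s x), and it lies in T *)
Definition one_parameter (gamma : R -> G) (x : 'rV[R]_d) : Prop :=
  [/\ continuous gamma,
      forall s u, gamma (s + u) = (gamma s * gamma u)%g,
      forall s, T (gamma s)
    & is_derive (0 : R^o) (1 : R^o) (coord c \o gamma) x].

Definition torus_lie : set 'rV[R]_d :=
  [set x | exists gamma, one_parameter gamma x].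

(* t^* as a subspace of k^*, through t^* ~ t and k ~ k^* *)
Definition torus_dual : set 'rV[R]_d := flat @` torus_lie.

Section Weights.
Variables (n : nat) (r : G -> 'M[R[i]]_n).

(* [chi] is the character of T by which T acts (through r) on some nonzero
   vector; representations act on column vectors. *)
Definition weight_character (chi : G -> R[i]) : Prop :=
  exists2 v : 'cV[R[i]]_n, v != 0 & forall g, T g -> r g *m v = chi g *: v.

(* [xi] in t^* is the differential of [chi] divided by i:
   d/ds chi(exp(s x)) = i xi(x) at s = 0, for all x in t *)
Definition differential_of (chi : G -> R[i]) (xi : 'rV[R]_d) : Prop :=
  torus_dual xi /\
  forall gamma x, one_parameter gamma x ->
    is_derive (0 : R^o) (1 : R^o)
      (fun s : R => complex.Re (chi (gamma s)) : R^o) 0 /\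
    is_derive (0 : R^o) (1 : R^o)
      (fun s : R => complex.Im (chi (gamma s)) : R^o) (pairing xi x).

(* For r = rho this is Lambda(V). *)
Definition weights : set 'rV[R]_d :=
  [set xi | exists2 chi, weight_character chi & differential_of chi xi].

(* The character, not only its differential, is required to be nontrivial; as T
   is connected this is the same as xi != 0. *)
Definition nontrivial_weights : set 'rV[R]_d :=
  [set xi | exists chi, [/\ weight_character chi,
    (exists2 g, T g & chi g != 1) & differential_of chi xi]].

End Weights.

(* Complexified adjoint representation; transposed to act on columns *)
Definition AdC (g : G) : 'M[R[i]]_d := map_mx (fun x : R => x%:C%C) (Ad g)^T.

Definition roots : set 'rV[R]_d := nontrivial_weights AdC.

Definition regular (xi : 'rV[R]_d) : Prop :=
  forall alpha, roots alpha -> dual_form xi alpha != 0.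

End Torus.

Definition convex_hull (M : set 'rV[R]_d) : set 'rV[R]_d :=
  [set x | exists m (p : 'I_m -> 'rV[R]_d) (a : 'I_m -> R),
    [/\ forall j, M (p j), forall j, 0 <= a j, \sum_j a j = 1
      & x = \sum_j a j *: p j]].

Definition closest_to_origin (M : set 'rV[R]_d) (xi : 'rV[R]_d) : Prop :=
  convex_hull M xi /\ forall y, convex_hull M y -> normsq xi <= normsq y.

Section Representation.
Variables (N : nat) (rho : G -> 'M[R[i]]_N).

Definition Xi (T : set G) : set 'rV[R]_d :=
  [set xi | exists M, [/\ M `<=` weights T rho, M !=set0
                        & closest_to_origin M xi]].

Definition hermitian (v w : 'cV[R[i]]_N) : R[i] :=
  \sum_j v j 0 * (w j 0)^*%C.

(* Differential of rho at the identity *)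
Definition drho (x : 'rV[R]_d) : 'M[R[i]]_N :=
  \matrix_(j, k)
    ('D_x (fun y => complex.Re (rho (param c y) j k) : R^o) p1 +i*
     'D_x (fun y => complex.Im (rho (param c y) j k) : R^o) p1)%C.

(* Momentum map in homogeneous coordinates: mu [v] for v != 0. The quotient
   <eta v, v> / (i <v, v>) is real since drho eta is skew-Hermitian. *)
Definition mu (v : 'cV[R[i]]_N) : 'rV[R]_d :=
  \row_j complex.Re
    (hermitian (drho (delta_mx 0 j) *m v) v / ('i%C * hermitian v v)).

(* [v] is a critical point of |mu|^2 on P(V): since V \ 0 -> P(V) is a
   submersion, this says that the lift of |mu|^2 to V \ 0 has zero (real)
   differential at v. *)
Definition critical (v : 'cV[R[i]]_N) : Prop :=
  forall w : 'cV[R[i]]_N,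
    is_derive (0 : R^o) (1 : R^o)
      (fun s : R => normsq (mu (v + s%:C%C *: w)) : R^o) 0.

(* Homogeneous coordinates of the points of C_xi *)
Definition critical_fibre (xi : 'rV[R]_d) : set 'cV[R[i]]_N :=
  [set v | [/\ v != 0, mu v = xi & critical v]].

Definition intermediate_critical_value (xi : 'rV[R]_d) : Prop :=
  critical_fibre xi !=set0.

End Representation.
End LieAlgebra.

Definition unitary_representation (G : topologicalGroupType)
    (L : lieGroup G) (N : nat) (rho : G -> 'M[R[i]]_N) : Prop :=
  [/\ rho 1%g = 1%:M,
      forall g h, rho (g * h)%g = rho g *m rho h,
      forall g, rho g \is unitarymx
    & forall a, atlas L a -> forall j k,
        smooth_on (crange a)
          (fun x => complex.Re (rho (param a x) j k) : R^o) /\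
        smooth_on (crange a)
          (fun x => complex.Im (rho (param a x) j k) : R^o)].

End LieGroups.

(* Main.v *)
Require Import Defs.
From HB Require Import structures.
From mathcomp Require Import all_boot all_order all_algebra.
From mathcomp Require Import complex spectral.
From mathcomp Require Import all_classical all_reals all_analysis.
From mathcomp Require Import ring lra zify.
Require Import Defs.

(** Why the theorem holds. Write [xi] as a convex combination of distinct weights
    [p j] with coefficients [a j], and put [v = \sum_j sqrt (a j) e_j], where
    [e_j] is a unit weight vector for [p j]. Distinct weights have orthogonal
    weight vectors, so the momentum [mu v] and [xi] take the same values on the
    Lie algebra t of [T].

    Let [x0] be the element of t that corresponds to [xi]. Since [xi] is the
    closest point to the origin of the convex hull, every [p j] with [a j != 0]
    lies on the hyperplane through [xi] orthogonal to [xi]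
    ([closest_support]), i.e. [p j (x0) = normsq xi]. Hence [v] is an
    eigenvector of [drho x0], and the point [v] of the projective space is fixed
    by the one-parameter subgroup of [x0]. By equivariance, so is [mu v]
    ([momentum_fixed]).

    Regularity enters now: an element of k that is fixed by the subgroup of a
    regular [x0] is fixed by all of [T] ([regular_fixed]), hence lies in t, as
    [T] is maximal ([torus_lie_centralizer]). So [mu v] lies in t^* and equals
    [xi]. Then [x0] is the element of k dual to [mu v], and [v] being an
    eigenvector of it is the critical point equation for [normsq (mu v)]
    ([eigen_critical]).

    The Lie theory behind this argument is developed from the charts. Tangent
    vectors are velocities of curves through the identity. One-parameter
    subgroups are limits of Euler products along an ultrafilter, which exist by
    compactness ([semigroup_exists]), and they are unique
    ([one_parameter_unique]). The sign-normalized Killing form is positive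
    definite ([kform_ge0]): [Ad] is bounded, so [ad x] generates a bounded group
    of matrices, and the trace of the square of such a generator is at most zero
    ([bounded_group_trace]). This gives orthogonal projections, invariance of
    orthogonal complements and imaginary derivatives of the characters of [T].
    A common eigenvector of [T] in the complexified complement of the part of k
    fixed by [T] therefore affords a root ([root_of_eigenvector]). *)

Set Implicit Arguments.
Unset Strict Implicit.
Unset Printing Implicit Defensive.

Import Order.TTheory GRing.Theory Num.Theory.
Import numFieldNormedType.Exports.

Local Open Scope classical_set_scope.
Local Open Scope ring_scope.

(** * Differential calculus of curves *)

(** A synonym of ['d f x] whose type fixes the real scalars of both sides. *)
Definition dif (R : realType) (V W : normedModType R) (f : V -> W) (x : V) : V -> W :=
  'd f x.

Lemma difP (R : realType) (V W : normedModType R) (f : V -> W) x a u v :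
  dif f x (a *: u + v) = a *: dif f x u + dif f x v.
Proof. by rewrite /dif linearP. Qed.

Lemma difD (R : realType) (V W : normedModType R) (f : V -> W) x u v :
  dif f x (u + v) = dif f x u + dif f x v.
Proof. by rewrite /dif linearD. Qed.

Lemma difZ (R : realType) (V W : normedModType R) (f : V -> W) x a u :
  dif f x (a *: u) = a *: dif f x u.
Proof. by rewrite /dif linearZ. Qed.

Lemma dif_sum (R : realType) (V W : normedModType R) (f : V -> W) x (I : Type)
    (r : seq I) (P : pred I) (F : I -> V) :
  dif f x (\sum_(i <- r | P i) F i) = \sum_(i <- r | P i) dif f x (F i).
Proof. by rewrite /dif linear_sum. Qed.

Lemma derive_dif (R : realType) (V W : normedModType R) (f : V -> W) x v :
  differentiable f x -> 'D_v f x = dif f x v.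
Proof. exact: deriveE. Qed.

Lemma dif_id (R : realType) (V : normedModType R) (x u : V) : dif id x u = u.
Proof. by rewrite /dif diff_val. Qed.

Section Curves.
Variable R : realType.

(** The form in which derivatives at 0 are estimated and glued. *)
Lemma is_derive0P (W : normedModType R) (f : R -> W) (x : W) :
  is_derive (0 : R^o) (1 : R^o) f x <->
  forall e, 0 < e -> \forall s \near (0 : R), `|f s - f 0 - s *: x| <= e * `|s|.
Proof.
split=> [[df <-] e e0|H].
  have cf : (fun h : R => h^-1 *: ((f \o shift (0:R)) (h *: (1 : R^o)) - f 0)) @ 0^' -->
    'D_1 (f : R^o -> W) 0 by exact: df.
  have /cvgrPdist_le /(_ e e0) := cf.
  rewrite near_withinE; apply: filterS => s H.
  have [->|s0] := eqVneq s 0; first by rewrite subrr sub0r scale0r !normrN !normr0 mulr0.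
  move: (H s0); rewrite /= addr0 /GRing.scale /= mulr1 => {}H.
  rewrite -normrN opprB -{1}(scalerKV s0 (f s - f 0)) -scalerBr normrZ mulrC.
  by rewrite ler_wpM2r.
suff cf : (fun h : R => h^-1 *: ((f \o shift (0:R)) (h *: (1 : R^o)) - f 0)) @ 0^' --> x.
  split; first by apply/cvg_ex; exists x.
  exact/cvg_lim.
apply/cvgrPdist_le => e e0; rewrite near_withinE.
have := H e e0; apply: filterS => s hs s0.
rewrite /= addr0 /GRing.scale /= mulr1.
rewrite -(scalerK s0 x) -[X in _ - X]/(s^-1 *: (f s - f 0)) -scalerBr normrZ normfV.
rewrite ler_pdivrMl ?normr_gt0// mulrC.
by rewrite -normrN opprB.
Qed.

Lemma is_derive_diff_comp (V W : normedModType R) (f : R -> V) (g : V -> W) s x :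
  is_derive (s : R^o) (1 : R^o) f x -> differentiable g (f s) ->
  is_derive (s : R^o) (1 : R^o) (g \o f) (dif g (f s) x).
Proof.
move=> [df <-] dg.
have df' : differentiable (f : R^o -> V) (s : R^o) by apply/derivable1_diffP.
split; first exact/derivable1_diffP/differentiable_comp.
rewrite (deriveE (f := (g \o f) : R^o -> W)); last exact: differentiable_comp.
by rewrite diff_comp//= deriveE /dif.
Qed.

Lemma is_derive_continuous (W : normedModType R) (f : R -> W) s x :
  is_derive (s : R^o) (1 : R^o) f x -> {for s, continuous f}.
Proof.
move=> [df _]; apply: (@differentiable_continuous _ R^o W).
exact/derivable1_diffP.
Qed.

Lemma is_derive_mxP m n (f : R -> 'M[R]_(m, n)) s x :
  is_derive (s : R^o) (1 : R^o) f x <->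
  forall i j, is_derive (s : R^o) (1 : R^o) (fun t => f t i j : R^o) (x i j).
Proof.
split=> [[df <-] i j|H].
  split; first exact: ((derivable_mxP _ _ _).1 df).
  by rewrite derive_mx// mxE.
have df : derivable (f : R^o -> _) s 1.
  by apply/derivable_mxP => i j; have [] := H i j.
split => //; rewrite derive_mx//; apply/matrixP => i j; rewrite mxE.
by have [] := H i j.
Qed.

(** Along a homomorphism [f (s + h)] is a translate of [f h], so this reduces
    derivatives at [s] to derivatives at 0. *)
Lemma is_derive_shift0 (W : normedModType R) (f : R -> W) s x :
  is_derive (0 : R^o) (1 : R^o) (fun h => f (s + h)) x ->
  is_derive (s : R^o) (1 : R^o) f x.
Proof.
move=> [df <-].
have E : (fun h : R => h^-1 *: ((((fun h => f (s + h)) : R^o -> W) \o shift (0 : R^o)) (h *: (1 : R^o)) - f (s + 0)))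
  = (fun h : R => h^-1 *: (((f : R^o -> W) \o shift (s : R^o)) (h *: (1 : R^o)) - f s)).
  by apply/funext => h /=; rewrite !addr0 [s + _]addrC.
by split; [move: df|]; rewrite /derivable /derive E.
Qed.

Lemma is_derive_line (W : normedModType R) (x v : W) (s : R) :
  is_derive (s : R^o) (1 : R^o) (fun t : R => x + t *: v) v.
Proof.
apply: is_derive_shift0; apply/is_derive0P => e e0; apply: filterE => t.
rewrite addr0 scalerDl addrA [X in X - _ - _]addrC addrK subrr normr0.
by rewrite mulr_ge0// ltW.
Qed.

Lemma is_derive_scale (W : normedModType R) (v : W) (s : R) :
  is_derive (s : R^o) (1 : R^o) (fun t : R => t *: v) v.
Proof. by have := is_derive_line 0 v s; under eq_fun do rewrite add0r. Qed.

Lemma zero_derive_cst m n (f : R -> 'M[R]_(m, n)) s t :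
  (forall u, is_derive (u : R^o) (1 : R^o) f 0) -> f s = f t.
Proof.
move=> H; apply/matrixP => i j.
apply: (@is_derive_0_is_cst R (fun u => f u i j)) => u.
by have := (is_derive_mxP _ _ _).1 (H u) i j; rewrite mxE.
Qed.

Lemma zero_derive_cst_near m n (f : R -> 'M[R]_(m, n)) e s :
  (forall u, `|u| < e -> is_derive (u : R^o) (1 : R^o) f 0) ->
  `|s| < e -> f s = f 0.
Proof.
move=> H se; apply/matrixP => i j.
have H' u : `|u| < e -> is_derive (u : R^o) (1 : R^o) (fun t => f t i j : R^o) 0.
  by move=> /H /is_derive_mxP /(_ i j); rewrite mxE.
have cst a b : a <= b -> - e < a -> b < e -> f a i j = f b i j.
  move=> ab ea be.
  have lte u : a <= u <= b -> `|u| < e.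
    by move=> /andP[au ub]; rewrite ltr_norml (lt_le_trans ea)//= (le_lt_trans ub).
  have [|u|c _] := @MVT_segment _ (fun t => f t i j) (fun=> 0) a b ab.
  - by move=> u; rewrite in_itv/= => /andP[/ltW au /ltW ub]; apply/H'/lte; rewrite au.
  - apply/continuous_in_subspaceT => v; rewrite inE/= in_itv/= => vab.
    by apply: is_derive_continuous; apply/H'/lte.
  - by rewrite mul0r => /eqP; rewrite subr_eq0 => /eqP.
move: se; rewrite ltr_norml => /andP[es se]; have e0 := lt_trans es se.
by have [s0|/ltW s0] := leP 0 s; [symmetry|]; apply: cst => //; lra.
Qed.

End Curves.

Section NearEq.
Variables (R : realType) (V W : normedModType R).

(** Compositions of chart maps agree with the map of interest only near the
    base point; differentials only depend on germs. *)
Lemma near_eq_diff (f g : V -> W) (x : V) :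
  (\forall y \near x, f y = g y) -> differentiable f x ->
  differentiable g x /\ dif g x = dif f x.
Proof.
move=> fg df.
have [cf Ef] := (diff_locallyP x f).1 df.
have Eg : g \o shift x = cst (g x) + 'd f x +o_ 0 id.
  apply/eqaddoP => e e0; have /eqaddoP /(_ e e0) := Ef.
  have : \forall y \near (0 : V), f (y + x) = g (y + x).
    rewrite (near_shift x) /=; apply: filterS fg => y.
    by rewrite /= sub0r addrNK.
  apply: filterS2 => y E; rewrite -/(f (y + x)) /= !fctE /=.
  by rewrite E -(nbhs_singleton fg).
have E := diff_unique cf Eg.
split; last exact: E.
apply/diff_locallyP; rewrite E; split; [exact: cf|exact: Eg].
Qed.

End NearEq.

Lemma diff_comp_near (R : realType) (U V W : normedModType R) (f : U -> V)
    (g : V -> W) (h : U -> W) x w :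
  f x = w -> (\forall y \near x, g (f y) = h y) ->
  differentiable f x -> differentiable g w ->
  differentiable h x /\ forall u, dif h x u = dif g w (dif f x u).
Proof.
case: w / => gfh df dg; have dgf := differentiable_comp df dg.
have [dh dhE] := near_eq_diff gfh dgf; split; first exact: dh.
by move=> u; rewrite dhE /dif diff_comp.
Qed.

Section MatrixValued.
Variables (R : realType) (V : normedModType R).

Lemma differentiable_mxP m n (f : V -> 'M[R]_(m, n)) x :
  (forall i j, differentiable (fun y => f y i j : R^o) x) -> differentiable f x.
Proof.
move=> H.
have -> : f = \sum_(i < m) \sum_(j < n) (fun y => f y i j *: delta_mx i j).
  apply/funext => y; rewrite fct_sumE {1}(matrix_sum_delta (f y)).
  by apply: eq_bigr => i _; rewrite fct_sumE.
by do 2![apply: differentiable_sum => ?]; apply: differentiableZl; apply: H.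
Qed.

Lemma differentiable_mulmx m n p (f : V -> 'M[R]_(m, n)) (g : V -> 'M[R]_(n, p)) x :
  differentiable f x -> differentiable g x ->
  differentiable (fun y => f y *m g y) x.
Proof.
move=> df dg; apply: differentiable_mxP => i j.
have -> : (fun y => (f y *m g y) i j) =
    \sum_(k < n) (fun y => f y i k) * (fun y => g y k j).
  by apply/funext => y; rewrite mxE fct_sumE.
apply: differentiable_sum => k; apply: differentiableM.
  exact: (differentiable_comp df (differentiable_coord _ _ _)).
exact: (differentiable_comp dg (differentiable_coord _ _ _)).
Qed.

Lemma is_derive_mulmx m n p (f : R -> 'M[R]_(m, n)) (g : R -> 'M[R]_(n, p)) s A B :
  is_derive (s : R^o) (1 : R^o) f A -> is_derive (s : R^o) (1 : R^o) g B ->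
  is_derive (s : R^o) (1 : R^o) (fun t => f t *m g t) (A *m g s + f s *m B).
Proof.
move=> /is_derive_mxP df /is_derive_mxP dg; apply/is_derive_mxP => i j.
have -> : (fun y => (f y *m g y) i j) =
    \sum_(k < n) (fun y => f y i k) * (fun y => g y k j).
  by apply/funext => y; rewrite mxE fct_sumE.
apply: is_derive_eq.
rewrite !mxE -big_split /=; apply: eq_bigr => k _.
by rewrite addrC /GRing.scale /= [A i k * _]mulrC.
Qed.

Lemma is_derive_mulmx_cst m n p q (A : 'M[R]_(m, n)) (f : R -> 'M[R]_(n, p))
    (B : 'M[R]_(p, q)) s X :
  is_derive (s : R^o) (1 : R^o) f X ->
  is_derive (s : R^o) (1 : R^o) (fun t => A *m f t *m B) (A *m X *m B).
Proof.
move=> df.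
have d1 := @is_derive_mulmx _ _ _ (fun=> A) f s 0 X (is_derive_cst _ _ _) df.
have d2 := @is_derive_mulmx _ _ _ (fun t => A *m f t) (fun=> B) s _ 0 d1 (is_derive_cst _ _ _).
by apply: is_derive_eq d2 _; rewrite mul0mx add0r mulmx0 addr0.
Qed.

End MatrixValued.

Lemma is_derive_pair (R : realType) (V W : normedModType R) (f : R -> V) (g : R -> W) s x y :
  is_derive (s : R^o) (1 : R^o) f x -> is_derive (s : R^o) (1 : R^o) g y ->
  is_derive (s : R^o) (1 : R^o) (fun t => (f t, g t)) (x, y).
Proof.
move=> [/derivable1_diffP df <-] [/derivable1_diffP dg <-].
have dfg := differentiable_pair df dg.
split; first exact/derivable1_diffP.
by rewrite (deriveE _ dfg) diff_pair// !deriveE.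
Qed.

Lemma is_derive_unique (R : realType) (W : normedModType R) (f : R -> W) s x y :
  is_derive (s : R^o) (1 : R^o) f x -> is_derive (s : R^o) (1 : R^o) f y -> x = y.
Proof. by move=> [_ <-] [_ <-]. Qed.

Section PairCst.
Variables (R : realType) (V W : normedModType R).

Lemma differentiable_pair_cstr (w : W) (x : V) : differentiable (fun y : V => (y, w)) x.
Proof. by apply: differentiable_pair; [exact: ex_diff|exact: differentiable_cst]. Qed.

Lemma differentiable_pair_cstl (w : W) (x : V) : differentiable (fun y : V => (w, y)) x.
Proof. by apply: differentiable_pair; [exact: differentiable_cst|exact: ex_diff]. Qed.

Lemma diff_pair_cstr (w : W) (x u : V) : dif (fun y : V => (y, w)) x u = (u, 0).
Proof.
rewrite /dif diff_pair; [|exact: ex_diff|exact: differentiable_cst].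
by rewrite diff_cst diff_val.
Qed.

Lemma diff_pair_cstl (w : W) (x u : V) : dif (fun y : V => (w, y)) x u = (0, u).
Proof.
rewrite /dif diff_pair; [|exact: differentiable_cst|exact: ex_diff].
by rewrite diff_cst diff_val.
Qed.

End PairCst.

(** * Lie groups in coordinates *)

Section TopologicalGroups.
Variable K : topologicalGroupType.

Lemma mulg_cvg (T : Type) (F : set_system T) {FF : Filter F} (f g : T -> K) a b :
  f @ F --> a -> g @ F --> b -> (fun x => (f x * g x)%g) @ F --> (a * b)%g.
Proof.
move=> fa gb.
by apply: (@continuous2_cvg _ K K K F FF f g (fun x y => (x * y)%g)) => //;
  exact: (@mulg_continuous K (a, b)).
Qed.

Lemma invg_cvg (T : Type) (F : set_system T) {FF : Filter F} (f : T -> K) a :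
  f @ F --> a -> (fun x => (f x)^-1%g) @ F --> (a^-1)%g.
Proof.
exact: (@continuous_cvg _ K K F FF f (fun x => (x^-1)%g) a (@invg_continuous K a)).
Qed.

End TopologicalGroups.

Section Charts.
Variables (R : realType) (d : nat) (K : topologicalGroupType).
Implicit Types a b : chart R d K.

Lemma crangeP a y : crange a y -> cdom a (param a y) /\ coord a (param a y) = y.
Proof. by move=> [x ax <-]; rewrite coordK. Qed.

Lemma near_cdom a g : cdom a g -> \forall x \near g, cdom a x.
Proof. by move=> ag; apply: open_nbhs_nbhs; split => //; apply: cdom_open. Qed.

Lemma near_crange a y : crange a y -> \forall x \near y, crange a x.
Proof. by move=> ay; apply: open_nbhs_nbhs; split => //; apply: crange_open. Qed.

Lemma param_cvg a g : cdom a g -> param a y @[y --> coord a g] --> g.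
Proof.
move=> ag; rewrite -[X in _ --> X](coordK ag).
by apply: param_continuous; exists g.
Qed.

Variable L : lieGroup R d K.

(** One-sided translations are restrictions of the multiplication, which is
    smooth in the charts, to lines where one factor is constant. *)
Lemma lmul_diff a b g z : atlas L a -> atlas L b -> cdom a z -> cdom b (g * z)%g ->
  differentiable (fun y => coord b (g * param a y)%g) (coord a z).
Proof.
move=> aL bL az bgz; have [e eL eg] := atlas_cover L g.
have [+ _] := mulg_smooth eL aL bL 1%N.
move=> /(_ (coord e g, coord a z)) /=; rewrite !coordK// => H.
have {}H := H (And3 (ex_intro2 _ _ g eg erefl) (ex_intro2 _ _ z az erefl) bgz).
have -> : (fun y => coord b (g * param a y)%g) =
  (fun z => coord b (param e z.1 * param a z.2)%g) \o (fun y => (coord e g, y)).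
  by apply/funext => y /=; rewrite coordK.
by apply: differentiable_comp => //; apply: differentiable_pair => //; apply: differentiable_cst.
Qed.

Lemma rmul_diff a b g z : atlas L a -> atlas L b -> cdom a z -> cdom b (z * g)%g ->
  differentiable (fun y => coord b (param a y * g)%g) (coord a z).
Proof.
move=> aL bL az bgz; have [e eL eg] := atlas_cover L g.
have [+ _] := mulg_smooth aL eL bL 1%N.
move=> /(_ (coord a z, coord e g)) /=; rewrite !coordK// => H.
have {}H := H (And3 (ex_intro2 _ _ z az erefl) (ex_intro2 _ _ g eg erefl) bgz).
have -> : (fun y => coord b (param a y * g)%g) =
  (fun z => coord b (param a z.1 * param e z.2)%g) \o (fun y => (y, coord e g)).
  by apply/funext => y /=; rewrite coordK.
by apply: differentiable_comp => //; apply: differentiable_pair => //; apply: differentiable_cst.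
Qed.

(** [g * y * h] factors through a third chart around [g * z]. *)
Lemma translate_diff a b g h z : atlas L a -> atlas L b -> cdom a z -> cdom b (g * z * h)%g ->
  differentiable (fun y => coord b (g * param a y * h)%g) (coord a z).
Proof.
move=> aL bL az bgzh; have [e eL eg] := atlas_cover L (g * z)%g.
have H1 := lmul_diff aL eL az eg; have H2 := rmul_diff eL bL eg bgzh.
have cv : (g * param a y)%g @[y --> coord a z] --> (g * z)%g.
  by apply: mulg_cvg (param_cvg az); apply: cvg_cst.
have {}cv : \forall y \near coord a z, cdom e (g * param a y)%g.
  by apply: cv; apply: near_cdom.
have E : \forall y \near coord a z, coord b (param e (coord e (g * param a y)) * h)%g =
    coord b (g * param a y * h)%g.
  by apply: filterS cv => y ey; rewrite coordK.
have fE : coord e (g * param a (coord a z))%g = coord e (g * z)%g by rewrite coordK.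
exact: (@diff_comp_near _ _ _ _ (fun y => coord e (g * param a y)%g)
  (fun y => coord b (param e y * h)%g) (fun y => coord b (g * param a y * h)%g)
  _ _ fE E H1 H2).1.
Qed.

End Charts.

(** * Velocities of curves through the identity *)

Section Velocity.
Variables (R : realType) (d : nat) (K : topologicalGroupType).
Variables (L : lieGroup R d K) (c : chart R d K).
Hypotheses (c_atlas : atlas L c) (c_one : cdom c 1%g).

Local Notation p1 := (coord c 1%g).

(** A tangent vector at the identity is handled through the curves that have it
    as derivative. Continuity at 0 is part of the definition: away from [cdom c]
    the map [coord c] is arbitrary, and its derivability along [k] would not
    force [k] to stay in the chart. *)
Definition velocity (k : R -> K) (x : 'rV[R]_d) : Prop :=
  [/\ k 0 = 1%g, k s @[s --> (0 : R)] --> (1%g : K)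
    & is_derive (0 : R^o) (1 : R^o) (coord c \o k) x].

Lemma velocity_unique k x y : velocity k x -> velocity k y -> x = y.
Proof. by move=> [_ _ hx] [_ _ hy]; apply: is_derive_unique hx hy. Qed.

Lemma velocity_fun (W : normedModType R) (phi : K -> W) k x :
  differentiable (phi \o param c) p1 -> velocity k x ->
  is_derive (0 : R^o) (1 : R^o) (phi \o k) (dif (phi \o param c) p1 x).
Proof.
move=> dphi [k0 kc kd].
have := is_derive_diff_comp (g := phi \o param c) kd.
rewrite /= k0 => /(_ dphi); apply: near_eq_is_derive.
have : \forall s \near (0 : R), cdom c (k s) by apply: kc; apply: near_cdom.
by apply: filterS => s ks; rewrite /= coordK.
Qed.

(** Every curve in the chart through the identity can be used to compute
    differentials of functions on the group. *)
Lemma velocity_of_coord (f : R -> 'rV[R]_d) x : f 0 = p1 ->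
  is_derive (0 : R^o) (1 : R^o) f x -> velocity (param c \o f) x.
Proof.
move=> f0 df; have cf : f s @[s --> (0 : R)] --> p1.
  by have := is_derive_continuous df; rewrite /prop_for /continuous_at f0.
split; first by rewrite /= f0 coordK.
  by apply: (@cvg_comp _ _ _ _ (param c) _ _ _ cf); apply: param_cvg.
apply: near_eq_is_derive df.
have : \forall s \near (0 : R), crange c (f s).
  by apply: cf; apply: near_crange; exists 1%g.
by apply: filterS => s /crangeP[_ /= ->].
Qed.

Lemma velocity_param x : velocity (fun s => param c (p1 + s *: x)) x.
Proof.
apply: (@velocity_of_coord (fun s => p1 + s *: x)); first by rewrite scale0r addr0.
exact: is_derive_line.
Qed.

Lemma velocity_cst : velocity (fun=> 1%g) 0.
Proof.
by split; [|exact: cvg_cst|exact: is_derive_cst].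
Qed.

Lemma velocity_scale k x a : velocity k x -> velocity (fun s => k (a * s)) (a *: x).
Proof.
move=> [k0 kc kd].
have al : (a * s) @[s --> (0:R)] --> (0 : R).
  by rewrite -[X in _ --> X](mulr0 a); apply: cvgMl_tmp; apply: cvg_id.
split; first by rewrite mulr0.
  exact: (@cvg_comp _ _ _ _ k _ _ _ al).
have da : is_derive (0 : R^o) (1 : R^o) (fun s : R => a * s : R^o) a.
  by have := is_derive_scale (a : R^o) 0; under eq_fun do rewrite [_ *: _]mulrC.
have [dk vk] := kd; have dk' := (derivable1_diffP _ _).1 dk.
have dk2 : differentiable ((coord c \o k) : R^o -> _) (a * 0 : R^o) by rewrite mulr0.
have := is_derive_diff_comp (g := (coord c \o k) : R^o -> _) da dk2.
move=> h; apply: is_derive_eq h _; rewrite mulr0.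
by rewrite -[X in dif _ _ X]mulr1 -[_ * 1]/(a *: (1 : R^o)) difZ -derive_dif// vk.
Qed.

Definition mulc (z : 'rV[R]_d * 'rV[R]_d) := coord c (param c z.1 * param c z.2)%g.
Definition invc (y : 'rV[R]_d) := coord c (param c y)^-1%g.

Definition mulc_dom : set ('rV[R]_d * 'rV[R]_d) :=
  [set z | [/\ crange c z.1, crange c z.2 & cdom c (param c z.1 * param c z.2)%g]].

Lemma mulc_diff z : mulc_dom z -> differentiable mulc z.
Proof. by have [+ _] := mulg_smooth c_atlas c_atlas c_atlas 1%N; apply. Qed.

Lemma crange_one : crange c p1. Proof. by exists 1%g. Qed.

Lemma mulc_dom_one : mulc_dom (p1, p1).
Proof. by split; [exact: crange_one|exact: crange_one|rewrite /= coordK// mulg1]. Qed.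

Lemma near_mulc_dom : \forall z \near (p1, p1), mulc_dom z.
Proof.
have c1 : (z.1 : 'rV[R]_d) @[z --> (p1, p1)] --> p1 by apply: cvg_fst.
have c2 : (z.2 : 'rV[R]_d) @[z --> (p1, p1)] --> p1 by apply: cvg_snd.
have m1 : (param c z.1 * param c z.2)%g @[z --> (p1, p1)] --> (1%g * 1%g : K)%g.
  apply: mulg_cvg.
    by apply: (@cvg_comp _ _ _ _ (param c) _ _ _ c1); apply: param_cvg.
  by apply: (@cvg_comp _ _ _ _ (param c) _ _ _ c2); apply: param_cvg.
near=> z; split.
- by near: z; apply: c1; apply: near_crange crange_one.
- by near: z; apply: c2; apply: near_crange crange_one.
- near: z; apply: m1; rewrite mulg1; exact: near_cdom.
Unshelve. all: by end_near. Qed.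

Lemma invc_diff : differentiable invc p1.
Proof.
have [+ _] := invg_smooth c_atlas c_atlas 1%N; apply.
by split; [exact: crange_one|rewrite /= coordK// invg1].
Qed.

(** The identity being neutral on both sides gives both partial differentials
    of the multiplication. *)
Lemma diff_mulc u v : dif mulc (p1, p1) (u, v) = u + v.
Proof.
have dm := mulc_diff mulc_dom_one.
have dl : dif mulc (p1, p1) (u, 0) = u.
  have E : \forall y \near p1, mulc (y, p1) = id y.
    near=> y; rewrite /= /mulc /= coordK// mulg1.
    suff /crangeP[_ ->] : crange c y by [].
    by near: y; apply: near_crange crange_one.
  rewrite -(diff_pair_cstr p1 p1 u).
  have [_ /(_ u) <-] := diff_comp_near erefl E (differentiable_pair_cstr p1 p1) dm.
  exact: dif_id.
have dr : dif mulc (p1, p1) (0, v) = v.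
  have E : \forall y \near p1, mulc (p1, y) = id y.
    near=> y; rewrite /= /mulc /= coordK// mul1g.
    suff /crangeP[_ ->] : crange c y by [].
    by near: y; apply: near_crange crange_one.
  rewrite -(diff_pair_cstl p1 p1 v).
  have [_ /(_ v) <-] := diff_comp_near erefl E (differentiable_pair_cstl p1 p1) dm.
  exact: dif_id.
have -> : (u, v) = (u, 0) + (0, v) by congr pair; rewrite ?addr0 ?add0r.
by rewrite difD dl dr.
Unshelve. all: by end_near. Qed.

Lemma velocity_mul k l x y : velocity k x -> velocity l y ->
  velocity (fun s => (k s * l s)%g) (x + y).
Proof.
move=> [k0 kc kd] [l0 lc ld]; split.
- by rewrite k0 l0 mulg1.
- by rewrite -[X in _ --> X]mulg1; apply: mulg_cvg.
have := is_derive_diff_comp (g := mulc) (is_derive_pair kd ld).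
rewrite /= k0 l0 => /(_ (mulc_diff mulc_dom_one)); rewrite diff_mulc.
apply: near_eq_is_derive; near=> s.
rewrite /= /mulc /= !coordK//; near: s.
  by apply: lc; apply: near_cdom.
by apply: kc; apply: near_cdom.
Unshelve. all: by end_near. Qed.

(** The inverse curve has some velocity, and it must cancel [x] in the product
    with [k]. *)
Lemma velocity_inv k x : velocity k x -> velocity (fun s => (k s)^-1%g) (- x).
Proof.
move=> kx.
have [y ky] : exists y, velocity (fun s => (k s)^-1%g) y.
  exists (dif (coord c \o (fun g : K => g^-1%g) \o param c) p1 x).
  have [k0 kc _] := kx; split; first by rewrite k0 invg1.
    by rewrite -[X in _ --> X]invg1; apply: invg_cvg.
  exact: velocity_fun invc_diff kx.
suff -> : - x = y by [].
apply/eqP; rewrite eq_sym -subr_eq0 opprK addrC.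
have := velocity_mul kx ky.
under eq_fun do rewrite mulgV.
by move=> /velocity_unique /(_ velocity_cst) ->.
Qed.

Lemma mul_mx_ext m n (A B : 'M[R]_(m, n)) : (forall x : 'rV_m, x *m A = x *m B) -> A = B.
Proof. by move=> H; apply/row_matrixP => i; rewrite !rowE H. Qed.

Lemma velocity_conj g k x : velocity k x ->
  velocity (fun s => (g * k s * g^-1)%g) (x *m Ad c g).
Proof.
move=> kx; have [k0 kc _] := kx.
split; first by rewrite k0 mulg1 mulgV.
  have kg : (g * k s)%g @[s --> (0 : R)] --> (g * 1)%g.
    by apply: mulg_cvg kc; exact: cvg_cst.
  have : (g * k s * g^-1)%g @[s --> (0 : R)] --> (g * 1 * g^-1)%g.
    by apply: mulg_cvg kg _; exact: cvg_cst.
  by rewrite mulg1 mulgV.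
rewrite /Ad mul_rV_lin1 -/(dif _ _ _).
apply: (velocity_fun (phi := fun k => coord c (g * k * g^-1)%g)) kx.
by apply: (translate_diff c_atlas c_atlas c_one); rewrite mulg1 mulgV.
Qed.

(** The order is reversed because matrices act on row vectors. *)
Lemma Ad_mul g h : Ad c (g * h)%g = Ad c h *m Ad c g.
Proof.
apply: mul_mx_ext => x; have kx := velocity_param x.
apply: velocity_unique (velocity_conj (g * h)%g kx) _.
have := velocity_conj g (velocity_conj h kx).
rewrite mulmxA; congr (velocity _ _); apply/funext => s.
by rewrite invgM !mulgA.
Qed.

Lemma Ad_one : Ad c 1%g = 1%:M.
Proof.
apply: mul_mx_ext => x; have kx := velocity_param x.
apply: velocity_unique (velocity_conj 1%g kx) _; rewrite mulmx1.
by under eq_fun do rewrite mul1g invg1 mulg1.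
Qed.

Lemma Ad_invl g : Ad c g^-1%g *m Ad c g = 1%:M.
Proof. by rewrite -Ad_mul mulgV Ad_one. Qed.

Lemma Ad_invr g : Ad c g *m Ad c g^-1%g = 1%:M.
Proof. by rewrite -Ad_mul mulVg Ad_one. Qed.

Lemma Ad_diffE g x :
  x *m Ad c g = dif (fun y => coord c (g * param c y * g^-1)%g) p1 x.
Proof.
have kx := velocity_param x; have [_ _ kg] := velocity_conj g kx.
apply: is_derive_unique kg _.
apply: (velocity_fun (phi := fun k => coord c (g * k * g^-1)%g)) kx.
by apply: (translate_diff c_atlas c_atlas c_one); rewrite mulg1 mulgV.
Qed.

(** Near the identity, conjugation by [param c y] is [z |-> mulc (mulc (y, z),
    invc y)], so that [Ad] is a product of two matrices of partial derivatives
    of the multiplication; they are differentiable because the multiplication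
    is of class C^2. *)
Lemma Ad_param_diff : differentiable (fun y => Ad c (param c y)) p1.
Proof.
have [dm /(_ _)] := mulg_smooth c_atlas c_atlas c_atlas 2%N.
rewrite -/mulc => dm2.
have dDm v : differentiable ('D_v mulc) (p1, p1).
  by have [+ _] := dm2 v; apply; exact: mulc_dom_one.
pose A y : 'M[R]_d := \matrix_(i, j) 'D_((0 : 'rV[R]_d, delta_mx 0 i : 'rV[R]_d)) mulc (y, p1) 0 j.
pose B y : 'M[R]_d := \matrix_(i, j) 'D_((delta_mx 0 i : 'rV[R]_d, 0 : 'rV[R]_d)) mulc (y, invc y) 0 j.
have invc1 : invc p1 = p1 by rewrite /invc coordK// invg1.
have dA : differentiable A p1.
  apply: differentiable_mxP => i j.
  have -> : (fun y => A y i j) = (fun x : 'rV_d => x 0 j : R^o) \o ('D_(((0 : 'rV[R]_d), delta_mx 0 i : 'rV[R]_d)) mulc) \o (fun y => (y, p1)).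
    by apply/funext => y; rewrite /A mxE.
  apply: differentiable_comp.
    exact: differentiable_pair_cstr.
  by apply: differentiable_comp => //; apply: differentiable_coord.
have dB : differentiable B p1.
  apply: differentiable_mxP => i j.
  have -> : (fun y => B y i j) = (fun x : 'rV_d => x 0 j : R^o) \o ('D_((delta_mx 0 i : 'rV[R]_d, (0 : 'rV[R]_d))) mulc) \o (fun y => (y, invc y)).
    by apply/funext => y; rewrite /B mxE.
  apply: differentiable_comp.
    by apply: differentiable_pair => //; apply: invc_diff.
  apply: differentiable_comp; last exact: differentiable_coord.
  by rewrite invc1.
apply: (near_eq_diff (f := fun y => A y *m B y) _ _).1; last exact: differentiable_mulmx.
have near1 : \forall y \near p1, mulc_dom (y, p1).
  have : (y, p1) @[y --> p1] --> (p1, p1).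
    exact: differentiable_continuous (differentiable_pair_cstr p1 p1).
  by apply; apply: near_mulc_dom.
have near2 : \forall y \near p1, mulc_dom (y, invc y).
  have : (y, invc y) @[y --> p1] --> (p1, p1).
    rewrite -{3}invc1; apply: (@differentiable_continuous _ _ _ p1 (fun y => (y, invc y))).
    by apply: differentiable_pair => //; exact: invc_diff.
  by apply; apply: near_mulc_dom.
have near3 : \forall y \near p1, cdom c (param c y)^-1%g.
  have : (param c y)^-1%g @[y --> p1] --> (1^-1%g : K).
    exact: invg_cvg (param_cvg c_one).
  by apply; rewrite invg1; apply: near_cdom.
near=> y.
have y1 : mulc_dom (y, p1) by near: y.
have y2 : mulc_dom (y, invc y) by near: y.
have y3 : cdom c (param c y)^-1%g by near: y.
have [yc _ _] := y1; have [yd yE] := crangeP yc.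
apply: mul_mx_ext => x; rewrite Ad_diffE.
have m1 : mulc (y, p1) = y by rewrite /mulc /= coordK// mulg1.
pose F z := mulc (y, z); pose G z := mulc (z, invc y).
have near_refl (z : 'rV[R]_d) (f : 'rV[R]_d -> 'rV[R]_d) : \forall z' \near z, f z' = f z'.
  exact: filterE.
have [dF FE] := @diff_comp_near _ _ _ _ (fun z => (y, z)) mulc F p1 _ erefl
  (near_refl p1 F) (differentiable_pair_cstl y p1) (mulc_diff y1).
have [dG GE] := @diff_comp_near _ _ _ _ (fun z => (z, invc y)) mulc G y _ erefl
  (near_refl y G) (differentiable_pair_cstr (invc y) y) (mulc_diff y2).
have Ax : x *m A y = dif F p1 x.
  rewrite FE diff_pair_cstl.
  rewrite {2}(row_sum_delta x).
  have -> : (0 : 'rV[R]_d, \sum_(j < d) x 0 j *: delta_mx 0 j : 'rV[R]_d) =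
     \sum_(j < d) x 0 j *: (0 : 'rV[R]_d, delta_mx 0 j : 'rV[R]_d).
    apply: (big_ind2 (fun (a : 'rV[R]_d * 'rV[R]_d) (b : 'rV[R]_d) => (0, b) = a)) => //.
      by move=> a b a' b' <- <-; congr pair; rewrite addr0.
    by move=> i _; congr pair; rewrite scaler0.
  rewrite dif_sum; apply/rowP => j; rewrite mxE summxE; apply: eq_bigr => i _.
  by rewrite difZ mxE /A mxE derive_dif//; exact: mulc_diff.
have Bx u : u *m B y = dif G y u.
  rewrite GE diff_pair_cstr.
  rewrite {2}(row_sum_delta u).
  have -> : (\sum_(j < d) u 0 j *: delta_mx 0 j : 'rV[R]_d, 0 : 'rV[R]_d) =
     \sum_(j < d) u 0 j *: (delta_mx 0 j : 'rV[R]_d, 0 : 'rV[R]_d).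
    apply: (big_ind2 (fun (a : 'rV[R]_d * 'rV[R]_d) (b : 'rV[R]_d) => (b, 0) = a)) => //.
      by move=> a b a' b' <- <-; congr pair; rewrite addr0.
    by move=> i _; congr pair; rewrite scaler0.
  rewrite dif_sum; apply/rowP => j; rewrite mxE summxE; apply: eq_bigr => i _.
  by rewrite difZ mxE /B mxE derive_dif//; exact: mulc_diff.
rewrite mulmxA Ax Bx.
have cv : (param c y * param c z)%g @[z --> p1] --> (param c y * 1)%g.
  by apply: mulg_cvg (param_cvg c_one); apply: cvg_cst.
have {}cv : \forall z \near p1, cdom c (param c y * param c z)%g.
  by apply: cv; rewrite mulg1; apply: near_cdom.
have E : \forall z \near p1, G (F z) = coord c (param c y * param c z * (param c y)^-1)%g.
  by apply: filterS cv => z cz; rewrite /G /F /mulc /invc /= !coordK.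
have [_ CE] := @diff_comp_near _ _ _ _ F G
  (fun z => coord c (param c y * param c z * (param c y)^-1)%g) p1 y m1 E dF dG.
by rewrite CE.
Unshelve. all: by end_near. Qed.

End Velocity.

(** * The Killing form *)

Section Killing.
Variables (R : realType) (d : nat) (K : topologicalGroupType).
Variables (L : lieGroup R d K) (c : chart R d K).
Hypotheses (c_atlas : atlas L c) (c_one : cdom c 1%g).

Local Notation p1 := (coord c 1%g).

Lemma adE x : ad c x = dif (Ad c \o param c) p1 x.
Proof. exact: derive_dif (Ad_param_diff c_atlas c_one). Qed.

Local Opaque ad Ad dif.

Lemma adP (a : R) (x y : 'rV[R]_d) : ad c (a *: x + y) = a *: ad c x + ad c y.
Proof. by rewrite !adE difP. Qed.

Lemma velocity_Ad k x : velocity c k x ->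
  is_derive (0 : R^o) (1 : R^o) (Ad c \o k) (ad c x).
Proof.
by move=> kx; rewrite adE; exact: velocity_fun (Ad_param_diff c_atlas c_one) kx.
Qed.

(** Differentiate [Ad (g k(s) g^-1)], a product of three matrices. *)
Lemma ad_Ad g x : ad c (x *m Ad c g) = Ad c g^-1%g *m ad c x *m Ad c g.
Proof.
have kx := velocity_param c_one x; set k := (fun s => _) in kx.
apply: is_derive_unique (velocity_Ad (velocity_conj c_atlas c_one g kx)) _.
have -> : Ad c \o (fun s => (g * k s * g^-1)%g) =
    (fun s => Ad c g^-1%g *m (Ad c (k s)) *m Ad c g).
  by apply/funext => s /=; rewrite !(Ad_mul c_atlas c_one) mulmxA.
exact: is_derive_mulmx_cst (velocity_Ad kx).
Qed.

Lemma killing_Ad g x y : killing c (x *m Ad c g) (y *m Ad c g) = killing c x y.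
Proof.
rewrite /killing !ad_Ad; move: (Ad_invr c_atlas c_one g).
move: (Ad c g) (Ad c g^-1%g) (ad c x) (ad c y) => P Q A B PQ.
by rewrite -!mulmxA mxtrace_mulC -!mulmxA PQ mulmx1 (mulmxA P) PQ mul1mx.
Qed.

Lemma kform_Ad g x y : kform c (x *m Ad c g) (y *m Ad c g) = kform c x y.
Proof. by rewrite /kform killing_Ad. Qed.

Lemma kformC x y : kform c x y = kform c y x.
Proof.
rewrite /kform /killing.
move: (ad c x).
move: (ad c y) => A B.
by rewrite mxtrace_mulC.
Qed.

Lemma kformPl (a : R) (x y z : 'rV[R]_d) : kform c (a *: x + y) z = a * kform c x z + kform c y z.
Proof.
by rewrite /kform /killing adP mulmxDl mxtraceD -scalemxAl mxtraceZ opprD mulrN.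
Qed.

Lemma kform_sumr x m (a : 'I_m -> R) (y : 'I_m -> 'rV[R]_d) :
  kform c x (\sum_i a i *: y i) = \sum_i a i * kform c x (y i).
Proof.
have k0 z : kform c 0 z = 0.
  have := kformPl (-1) 0 0 z; rewrite scaler0 addr0 => ->.
  by rewrite mulN1r addNr.
have kD u v : kform c x (u + v) = kform c x u + kform c x v.
  have := kformPl 1 u v x; rewrite scale1r mul1r => E.
  by rewrite (kformC x) (kformC x u) (kformC x v).
have kZ b u : kform c x (b *: u) = b * kform c x u.
  have := kformPl b u 0 x; rewrite k0 !addr0 => E.
  by rewrite (kformC x) (kformC x u).
rewrite (big_morph _ kD (_ : _ = 0)); last by rewrite kformC k0.
by apply: eq_bigr => i _; rewrite kZ.
Qed.

Lemma kformE x y : kform c x y = (x *m kgram c *m y^T) 0 0.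
Proof.
rewrite {1}(row_sum_delta y) kform_sumr mxE; apply: eq_bigr => j _.
rewrite mulrC mxE kformC; congr (_ * _); last by rewrite mxE.
rewrite {1}(row_sum_delta x) kform_sumr; apply: eq_bigr => i _.
by rewrite mxE kformC.
Qed.

Lemma pairingE (f x : 'rV[R]_d) : pairing f x = (f *m x^T) 0 0.
Proof. by rewrite mxE; apply: eq_bigr => i _; rewrite mxE. Qed.

Lemma pairing_flat x y : pairing (flat c x) y = kform c x y.
Proof. by rewrite pairingE kformE. Qed.

Lemma pairing_inj (f g : 'rV[R]_d) : (forall x, pairing f x = pairing g x) -> f = g.
Proof.
move=> fg; apply/rowP => i; have := fg (delta_mx 0 i).
by rewrite !pairingE trmx_delta -!colE !mxE.
Qed.

Lemma linear_pairing (l : 'rV[R]_d -> R) :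
  (forall a x y, l (a *: x + y) = a * l x + l y) ->
  forall x, pairing (\row_i l (delta_mx 0 i)) x = l x.
Proof.
move=> lP x; have l0 : l 0 = 0.
  by have := lP 1 0 0; rewrite scale1r addr0 mul1r => /eqP; rewrite eq_sym -subr_eq0 addrK => /eqP.
have lZ a u : l (a *: u) = a * l u by rewrite -[_ *: _]addr0 lP l0 addr0.
have lD u v : l (u + v) = l u + l v by rewrite -[u]scale1r lP mul1r scale1r.
rewrite /pairing [in RHS](row_sum_delta x) (big_morph l lD l0).
by apply: eq_bigr => i _; rewrite mxE lZ mulrC.
Qed.

Hypothesis K_semisimple : semisimple c.

Lemma kgram_unit : kgram c \in unitmx.
Proof.
rewrite -row_free_unit -kermx_eq0; apply/rowV0P => x /sub_kermxP xG.
apply: K_semisimple => y; apply/eqP; rewrite -oppr_eq0 -/(kform c x y).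
by rewrite kformE xG mul0mx mxE.
Qed.

Lemma sharpK f : flat c (sharp c f) = f.
Proof. by rewrite /flat /sharp mulmxKV// kgram_unit. Qed.

Lemma flatK x : sharp c (flat c x) = x.
Proof. by rewrite /flat /sharp mulmxK// kgram_unit. Qed.

Lemma kform_sharp f x : kform c (sharp c f) x = pairing f x.
Proof. by rewrite -pairing_flat sharpK. Qed.

End Killing.

(** * One-parameter subgroups *)

Section MatrixNorm.
Variables (R : realType) (m n : nat).

Lemma mx_entry_le (M : 'M[R]_(m, n)) i j : `|M i j| <= `|M|.
Proof.
rewrite [leRHS]/Num.Def.normr/= mx_normrE.
exact: (le_bigmax _ (fun ij : 'I_m * 'I_n => `|M ij.1 ij.2|) (i, j)).
Qed.

Lemma mx_norm_le (M : 'M[R]_(m, n)) b :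
  0 <= b -> (forall i j, `|M i j| <= b) -> `|M| <= b.
Proof.
move=> b0 H; rewrite [leLHS]/Num.Def.normr/= mx_normrE.
by apply: bigmax_le => // -[i j] _ /=.
Qed.

End MatrixNorm.

Section Estimates.
Variables (R : realType) (d : nat) (K : topologicalGroupType).
Variables (L : lieGroup R d K) (c : chart R d K).
Hypotheses (c_atlas : atlas L c) (c_one : cdom c 1%g).

Local Notation p1 := (coord c 1%g).

Lemma dif_mulc_sum z v :
  dif (mulc c) z (0, v) = \sum_i v 0 i *: dif (mulc c) z (0, delta_mx 0 i).
Proof.
rewrite {1}(row_sum_delta v).
have -> : (0 : 'rV[R]_d, \sum_(j < d) v 0 j *: delta_mx 0 j : 'rV[R]_d) =
   \sum_(j < d) v 0 j *: (0 : 'rV[R]_d, delta_mx 0 j : 'rV[R]_d).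
  apply: (big_ind2 (fun (a : 'rV[R]_d * 'rV[R]_d) (b : 'rV[R]_d) => (0, b) = a)) => //.
    by move=> a b a' b' <- <-; congr pair; rewrite addr0.
  by move=> i _; congr pair; rewrite scaler0.
by rewrite dif_sum; apply: eq_bigr => i _; rewrite difZ.
Qed.

(** The differential of the multiplication in its second argument is the
    identity at the unit, and stays close to it since it is continuous. *)
Lemma near_dif_mulc (e : R) : 0 < e -> \forall z \near (p1, p1),
  mulc_dom c z /\ forall v, `|dif (mulc c) z (0, v) - v| <= e * `|v|.
Proof.
move=> e0; pose e' := e / d.+1%:R.
have e'0 : 0 < e' by rewrite divr_gt0.
have near_i (i : 'I_d) : \forall z \near (p1, p1),
    `|delta_mx 0 i - 'D_(0 : 'rV[R]_d, delta_mx 0 i : 'rV[R]_d) (mulc c) z| <= e'.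
  have [_ /(_ (0, delta_mx 0 i) (p1, p1) (mulc_dom_one c_one)) cD] :=
    mulg_smooth c_atlas c_atlas c_atlas 1%N.
  have E : 'D_(0 : 'rV[R]_d, delta_mx 0 i : 'rV[R]_d) (mulc c) (p1, p1) = delta_mx 0 i.
    rewrite derive_dif; last exact: (mulc_diff c_atlas (mulc_dom_one c_one)).
    by rewrite (diff_mulc c_atlas c_one) add0r.
  move: cD; rewrite /prop_for /continuous_at -/(mulc c) E.
  by move/cvgrPdist_le => /(_ _ e'0).
have near_all : \forall z \near (p1, p1), forall i : 'I_d,
    `|delta_mx 0 i - 'D_(0 : 'rV[R]_d, delta_mx 0 i : 'rV[R]_d) (mulc c) z| <= e'.
  exact: (@filter_forall _ _ (fun (i : 'I_d) z => `|delta_mx 0 i -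
    'D_(0 : 'rV[R]_d, delta_mx 0 i : 'rV[R]_d) (mulc c) z| <= e') _ _ near_i).
near=> z.
have zD : mulc_dom c z by near: z; exact: near_mulc_dom.
split=> // v.
have zi i : `|delta_mx 0 i - dif (mulc c) z (0, delta_mx 0 i)| <= e'.
  rewrite -derive_dif; last exact: (mulc_diff c_atlas zD).
  by move: i; near: z.
rewrite dif_mulc_sum [X in _ - X](row_sum_delta v) -sumrB.
apply: (@le_trans _ _ (\sum_(i < d) e' * `|v|)).
  apply: le_trans (ler_norm_sum _ _ _) _; apply: ler_sum => i _.
  rewrite -scalerBr normrZ -normrN opprB mulrC ler_pM//.
  exact: mx_entry_le.
have -> : e = e' * d.+1%:R by rewrite divfK.
rewrite sumr_const card_ord -[leLHS]mulr_natr mulrAC ler_wpM2r//.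
by rewrite ler_wpM2l ?(ltW e'0)// ler_nat.
Unshelve. all: by end_near. Qed.

(** The multiplication is strictly differentiable at the identity; no second
    derivative enters, and the error is proportional to the second factor
    alone, which lets it be summed along powers. *)
Lemma mulc_estimate (e : R) : 0 < e -> exists2 r, 0 < r & forall u y : 'rV[R]_d,
  `|u - p1| < r -> `|y - p1| < r ->
  mulc_dom c (u, y) /\ `|mulc c (u, y) - u - (y - p1)| <= e * `|y - p1|.
Proof.
move=> e0; have /nbhs_ballP[r /= r0 H] := near_dif_mulc e0.
exists r => // u y ur yr; set v := y - p1.
have {}H w : `|w - p1| < r ->
    mulc_dom c (u, w) /\ `|dif (mulc c) (u, w) (0, v) - v| <= e * `|v|.
  move=> wr; have [] := H (u, w).
    by split; rewrite -ball_normE /ball_ /= distrC.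
  by move=> uD /(_ v).
split; first by have [] := H y yr.
have seg t : 0 <= t <= 1 -> `|p1 + t *: v - p1| < r.
  move=> /andP[t0 t1]; rewrite [p1 + _]addrC addrK normrZ ger0_norm//.
  by rewrite (le_lt_trans _ yr)// ler_piMl.
have dphi t : 0 <= t <= 1 -> is_derive (t : R^o) (1 : R^o)
    (fun s : R => mulc c (u, p1 + s *: v)) (dif (mulc c) (u, p1 + t *: v) (0, v)).
  move=> t01; have [tD _] := H _ (seg t t01).
  have dp := is_derive_pair (is_derive_cst u (t : R^o) (1 : R^o)) (is_derive_line p1 v t).
  exact: (is_derive_diff_comp dp (mulc_diff c_atlas tD)).
apply: mx_norm_le; first by rewrite mulr_ge0// ltW.
move=> i j.
have [||t t01 E] := @MVT_segment R (fun s => mulc c (u, p1 + s *: v) i j)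
    (fun t => dif (mulc c) (u, p1 + t *: v) (0, v) i j) 0 1 ler01.
- move=> t; rewrite in_itv/= => /andP[/ltW t0 /ltW t1].
  by have /is_derive_mxP := dphi t (introT andP (conj t0 t1)); apply.
- apply/continuous_in_subspaceT => t; rewrite inE/= in_itv/= => t01.
  have /is_derive_mxP /(_ i j) := dphi t t01; exact: is_derive_continuous.
have py : p1 + v = y by rewrite addrC subrK.
move: E; rewrite scale0r addr0 scale1r py subr0 mulr1.
have -> : mulc c (u, p1) = u.
  have [[uc _ _] _] := H y yr; have [ud uE] := crangeP uc.
  by rewrite /mulc /= coordK// mulg1.
move=> E; have [_ bd] := H _ (seg t t01); apply: le_trans bd.
apply: le_trans (mx_entry_le _ i j).
have mxB (A B C : 'M[R]_(1, d)) : (A - B - C) i j = A i j - B i j - C i j by rewrite !mxE.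
by rewrite mxB E !mxE.
Qed.

End Estimates.

Lemma ultra_compact_cvg (T : Type) (X : topologicalType) (U : set_system T)
    (A : set X) (f : T -> X) : UltraFilter U -> compact A ->
  (\forall n \near U, A (f n)) -> exists2 p, A p & f n @[n --> U] --> p.
Proof.
move=> UU cA Af; have [p [Ap clp]] := cA (f @ U) _ Af.
exists p => // B Bp; have [//|nB] := in_ultra_setVsetC (f @^-1` B) UU.
by have [x [nBx Bx]] := clp (~` B) B nB Bp.
Qed.

Section Exponential.
Variables (R : realType) (d : nat) (K : topologicalGroupType).
Variables (L : lieGroup R d K) (c : chart R d K).
Hypotheses (c_atlas : atlas L c) (c_one : cdom c 1%g).

Local Notation p1 := (coord c 1%g).

(** Along the powers of an element close to the identity, the estimate of
    [mulc_estimate] adds up, so that the coordinates of a power are close to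
    the corresponding multiple. *)
Lemma power_estimate (e : R) : 0 < e -> exists2 r, 0 < r &
  forall (w : 'rV[R]_d) k, `|w| < r -> k%:R * ((1 + e) * `|w|) < r ->
  cdom c (param c (p1 + w) ^+ k)%g /\
  `|coord c (param c (p1 + w) ^+ k)%g - p1 - k%:R *: w| <= e * (k%:R * `|w|).
Proof.
move=> e0; have [r r0 H] := mulc_estimate c_atlas c_one e0; exists r => // w k wr.
have w1 : p1 + w - p1 = w by rewrite addrC addKr.
elim: k => [|k IH] kr.
  by rewrite expg0 subrr sub0r scale0r normrN normr0 !mul0r mulr0.
have ew0 : 0 <= (1 + e) * `|w| by rewrite mulr_ge0// addr_ge0// ltW.
have {}IH := IH (le_lt_trans (ler_wpM2r ew0 (_ : k%:R <= k.+1%:R)) kr).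
have [|kD kE] := IH; first by rewrite ler_nat.
set x := coord c _ in kE.
have xr : `|x - p1| < r.
  have -> : x - p1 = (x - p1 - k%:R *: w) + k%:R *: w by rewrite subrK.
  apply: le_lt_trans (ler_normD _ _) _; rewrite normrZ normr_nat.
  apply: le_lt_trans (lerD kE (lexx _)) _; apply: le_lt_trans kr.
  have : 0 <= (1 + e) * `|w| by [].
  rewrite -natr1; lra.
have [|[_ _ gD] gE] := H x (p1 + w) xr; first by rewrite w1.
move: gD gE; rewrite /mulc /= coordK// -expgSr w1 => gD gE; split=> //.
rewrite -natr1 scalerDl scale1r.
have -> : coord c (param c (p1 + w) ^+ k.+1)%g - p1 - (k%:R *: w + w) =
   (coord c (param c (p1 + w) ^+ k.+1)%g - x - w) + (x - p1 - k%:R *: w).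
  by apply/rowP => j; rewrite !mxE; ring.
apply: le_trans (ler_normD _ _) _; apply: le_trans (lerD gE kE) _.
by rewrite mulrDl mulrDr mul1r addrC.
Qed.

Lemma closed_normB (y0 : 'rV[R]_d) b : closed [set y | `|y - y0| <= b].
Proof.
apply: (@preimage_closed _ _ (fun y : 'rV[R]_d => `|y - y0|) [set x | x <= b]).
  move=> y _; have := @cvgB _ _ _ (nbhs y) _ id (cst y0) y y0 cvg_id (cvg_cst y0).
  by move=> H; exact: (cvg_norm (H _ _)).
exact: closed_le.
Qed.

Lemma compact_normB (y0 : 'rV[R]_d) b : compact [set y | `|y - y0| <= b].
Proof.
apply: bounded_closed_compact; last exact: closed_normB.
exists (b + `|y0|); split; first exact: num_real.
move=> x xb y /= yb; rewrite -[y](subrK y0).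
by apply: le_trans (ler_normD _ _) _; apply: le_trans (ltW xb); rewrite lerD2r.
Qed.

(** The defect [e] is what separates Euler products from a true semigroup; it
    is at most one factor tending to the identity. *)
Lemma truncn_add (a b : R) : 0 <= a -> 0 <= b -> exists e : bool,
  Num.truncn (a + b) = (Num.truncn a + Num.truncn b + e)%N.
Proof.
move=> a0 b0; have /andP[a1 a2] := truncn_itv a0; have /andP[b1 b2] := truncn_itv b0.
set m := Num.truncn a in a1 a2 *; set n := Num.truncn b in b1 b2 *.
have [lt|ge] := ltP (a + b) (m + n).+1%:R.
  exists false; rewrite addn0; apply: truncn_def; rewrite lt andbT natrD.
  by rewrite lerD.
exists true; rewrite addn1; apply: truncn_def; rewrite ge /=.
by move: a2 b2; rewrite -!natr1 natrD; lra.
Qed.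

Lemma truncn_div_cvg (s : R) : 0 <= s ->
  (Num.truncn (n.+1%:R * s))%:R / n.+1%:R @[n --> \oo] --> s.
Proof.
move=> s0; apply/cvgrPdist_le => e e0.
have /cvgrPdist_le /(_ _ e0) := @cvg_harmonic R; apply: filterS => n.
rewrite sub0r normrN ger0_norm ?invr_ge0 ?ler0n// => ne.
have n0 : 0 < n.+1%:R :> R by rewrite ltr0n.
have /truncn_itv/andP[t1 t2] : 0 <= n.+1%:R * s by rewrite mulr_ge0// ltW.
apply: le_trans ne; rewrite ger0_norm.
  rewrite lerBlDr -(ler_pM2l n0) mulrDr [X in _ + X]mulrC divfK ?gt_eqF//.
  by rewrite mulfV ?gt_eqF// addrC natr1 ltW.
by rewrite subr_ge0 ler_pdivrMr// [s * _]mulrC.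
Qed.

(** On the half-line the one-parameter semigroup is the limit of the Euler
    products [param c (p1 + z / n) ^ floor (n s)]. A limit along an ultrafilter
    exists by compactness and commutes with every continuous operation, so the
    semigroup law needs no estimate; only the velocity at 0 does. *)
Lemma semigroup_exists (K_compact : compact [set: K]) (z : 'rV[R]_d) :
  exists P : R -> K, [/\ P 0 = 1%g,
    forall s u : R, 0 <= s -> 0 <= u -> P (s + u) = (P s * P u)%g
  & forall e : R, 0 < e -> exists2 r : R, 0 < r & forall s : R, 0 <= s < r ->
      cdom c (P s) /\ `|coord c (P s) - p1 - s *: z| <= e * s].
Proof.
pose w n := n.+1%:R^-1 *: z; pose g n := param c (p1 + w n).
pose k (s : R) (n : nat) := (g n ^+ Num.truncn (n.+1%:R * s))%g.
have [U [UU ooU]] := ultraFilterLemma (@eventually_filter).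
have [P Pk] : {P : R -> K & forall s : R, k s n @[n --> U] --> P s}.
  apply: (@choice _ _ (fun (s : R) (p : K) => k s n @[n --> U] --> p)) => s.
  by have [|p _ kp] := ultra_compact_cvg (f := k s) UU K_compact; [exact: filterT|exists p].
have uniq (f : nat -> K) (a b : K) : f n @[n --> U] --> a -> f n @[n --> U] --> b -> a = b.
  by move=> fa fb; exact: (@cvg_unique K (lie_hausdorff L) (f @ U) _ a b fa fb).
have w0 : w n @[n --> \oo] --> (0 : 'rV[R]_d).
  by rewrite -[X in _ --> X](scale0r z); apply: cvgZr_tmp cvg_harmonic.
have g1 : g n @[n --> U] --> (1%g : K).
  have [_ pc _] := velocity_param c_one z.
  have := cvg_comp _ _ (@cvg_harmonic R) pc => H A A1.
  exact: ooU (H A A1).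
exists P; split.
- apply: uniq (Pk 0) _; have -> : k 0 = fun=> 1%g; last exact: cvg_cst.
  by apply/funext => n; rewrite /k mulr0 truncn0 expg0.
- move=> s u s0 u0; apply: uniq (Pk _) _.
  have [b bE] : {b : nat -> bool & forall n, Num.truncn (n.+1%:R * (s + u)) =
      (Num.truncn (n.+1%:R * s) + Num.truncn (n.+1%:R * u) + b n)%N}.
    apply: (@choice _ _ (fun n (b : bool) => Num.truncn (n.+1%:R * (s + u)) =
      (Num.truncn (n.+1%:R * s) + Num.truncn (n.+1%:R * u) + b)%N)) => n.
    by rewrite mulrDr; apply: truncn_add; rewrite mulr_ge0.
  have -> : k (s + u) = fun n => (k s n * k u n * g n ^+ b n)%g.
    by apply/funext => n; rewrite /k bE !expgnDr.
  rewrite -[X in _ --> X]mulg1; apply: mulg_cvg; first exact: mulg_cvg.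
  move=> A A1; have gA : \forall n \near U, A (g n) := g1 A A1.
  have : \forall n \near U, A (g n ^+ b n)%g; last exact.
  apply: filterS gA => n gA.
  by case: (b n); rewrite ?expg0 ?expg1//; exact: nbhs_singleton.
move=> e e0; pose e' := e / (`|z| + 1).
have z1 : 0 < `|z| + 1 by rewrite ltr_wpDl.
have e'0 : 0 < e' by rewrite divr_gt0.
have [r1 r10 Hr1] := power_estimate e'0.
have /nbhs_ballP[r2 /= r20 Hr2] := near_crange (crange_one c_one).
pose b := Num.min r1 (r2 / 2).
have b0 : 0 < b by rewrite /b lt_min r10 divr_gt0.
have e'1 : 0 < 1 + e' by rewrite addr_gt0.
exists (b / ((1 + e') * (`|z| + 1))); first by rewrite divr_gt0// mulr_gt0.
move=> s /andP[s0]; rewrite ltr_pdivlMr ?mulr_gt0// => sb.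
have szb : s * ((1 + e') * `|z|) <= b.
  apply: le_trans (ltW sb); rewrite ler_wpM2l// ler_wpM2l ?(ltW e'1)//.
  by rewrite lerDl.
pose kz n := (Num.truncn (n.+1%:R * s))%:R / n.+1%:R : R.
have kzs n : 0 <= kz n <= s.
  rewrite divr_ge0//= ler_pdivrMr ?ltr0n// [s * _]mulrC.
  by have /truncn_itv/andP[] : 0 <= n.+1%:R * s by rewrite mulr_ge0.
(* Near 0 the Euler products stay in the chart, with a uniform error. *)
have est : \forall n \near U, cdom c (k s n) /\
    `|coord c (k s n) - p1 - kz n *: z| <= e' * (s * `|z|).
  have : \forall n \near \oo, `|w n| < r1.
    by have := cvgr_norm_lt _ w0; apply; rewrite normr0.
  move=> /ooU; apply: filterS => n wr.
  have wz a : a * `|w n| = a / n.+1%:R * `|z|.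
    by rewrite normrZ gtr0_norm ?invr_gt0 ?ltr0n// mulrA.
  have /andP[kz0 kzs'] := kzs n.
  have kw : (Num.truncn (n.+1%:R * s))%:R * ((1 + e') * `|w n|) < r1.
    rewrite mulrCA wz -/(kz n) mulrCA.
    have br : b <= r1 by rewrite /b ge_min lexx.
    apply: lt_le_trans br; apply: le_lt_trans sb.
    apply: ler_pM => //; first by rewrite mulr_ge0// ltW.
    by rewrite ler_wpM2l ?(ltW e'1)// lerDl.
  have [kD kE] := Hr1 (w n) _ wr kw; split => //.
  rewrite -scalerA -/(w n); apply: le_trans kE _.
  by rewrite wz ler_wpM2l ?(ltW e'0)// ler_wpM2r.
have near_b : \forall n \near U, `|coord c (k s n) - p1| <= b.
  apply: filterS est => n [_ kE]; apply: le_trans szb.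
  rewrite -(subrK (kz n *: z) (_ - p1)); apply: le_trans (ler_normD _ _) _.
  have /andP[kz0 kzs'] := kzs n.
  rewrite normrZ (ger0_norm kz0); apply: le_trans (lerD kE (ler_wpM2r _ kzs')) _ => //.
  lra.
have [y yb ky] := ultra_compact_cvg (f := coord c \o k s) UU (@compact_normB p1 b) near_b.
have yr : crange c y.
  apply: Hr2; rewrite -ball_normE /ball_ /= distrC; apply: le_lt_trans yb _.
  have : b <= r2 / 2 by rewrite /b ge_min lexx orbT.
  by move=> /le_lt_trans; apply; rewrite ltr_pdivrMr// ltr_pMr// ltr1n.
have Py : P s = param c y.
  apply: uniq (Pk s) _.
  have H := cvg_comp _ _ ky (param_continuous yr).
  move=> A A1; have HA : \forall n \near U, A (param c (coord c (k s n))) := H A A1.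
  have : \forall n \near U, A (k s n); last exact.
  by apply: filterS2 est HA => n [kD _] /=; rewrite coordK.
have [yd yE] := crangeP yr; rewrite Py; split => //; rewrite yE.
have lim : (coord c (k s n) - p1 - kz n *: z) @[n --> U] --> y - p1 - s *: z.
  have l1 : (coord c (k s n) - p1) @[n --> U] --> y - p1.
    exact: cvgB ky (cvg_cst p1).
  apply: cvgB l1 _.
  apply: cvgZr_tmp => A As; apply: ooU; exact: (truncn_div_cvg s0).
have : `|y - p1 - s *: z - 0| <= e' * (s * `|z|).
  apply: (closed_cvg _ (@closed_normB 0 _) _ _ lim).
  by apply: filterS est => n [_]; rewrite /= subr0.
rewrite subr0 => /le_trans; apply.
rewrite mulrCA mulrC ler_wpM2r// /e' mulrAC ler_pdivrMr// ler_wpM2l ?(ltW e0)//.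
by rewrite lerDl.
Qed.

End Exponential.

Section OneParameter.
Variables (R : realType) (d : nat) (K : topologicalGroupType).
Variables (L : lieGroup R d K) (c : chart R d K).
Hypotheses (c_atlas : atlas L c) (c_one : cdom c 1%g).

Local Notation p1 := (coord c 1%g).

Lemma one_parameter0 (T : set K) gamma x : one_parameter c T gamma x -> gamma 0 = 1%g.
Proof.
by move=> [_ gD _ _]; apply: (mulgI (gamma 0)); rewrite -gD addr0 mulg1.
Qed.

Lemma one_parameterN (T : set K) gamma x s : one_parameter c T gamma x ->
  gamma (- s) = (gamma s)^-1%g.
Proof.
move=> gx; have g0 := one_parameter0 gx; have [_ gD _ _] := gx.
by apply: (mulgI (gamma s)); rewrite -gD subrr mulgV.
Qed.

Lemma one_parameter_velocity (T : set K) gamma x :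
  one_parameter c T gamma x -> velocity c gamma x.
Proof.
move=> gx; have g0 := one_parameter0 gx; have [gc _ _ gd] := gx.
by split => //; rewrite -[X in _ --> X]g0; exact: gc.
Qed.

(** By the homomorphism property continuity is only needed at 0. *)
Lemma one_parameter_of_velocity (T : set K) gamma x :
  (forall s u, gamma (s + u) = gamma s * gamma u)%g -> (forall s, T (gamma s)) ->
  velocity c gamma x -> one_parameter c T gamma x.
Proof.
move=> gD gT [g0 gc gd]; split => // s.
have : (gamma s * gamma u)%g @[u --> (0 : R)] --> (gamma s * 1)%g.
  by apply: mulg_cvg gc; exact: cvg_cst.
rewrite mulg1 => H A As; have HA : \forall u \near (0 : R), A (gamma s * gamma u)%g := H A As.
have : \forall t \near s, A (gamma t).
  rewrite (near_shift 0) /=; near=> u; rewrite /= subr0.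
  rewrite addrC gD.
  near: u; exact: HA.
exact.
Unshelve. all: by end_near. Qed.

(** Gluing of the two half-lines of a one-parameter subgroup. *)
Lemma velocity_or k l m x : velocity c k x -> velocity c l x -> m 0 = 1%g ->
  (\forall s \near (0 : R), m s = k s \/ m s = l s) -> velocity c m x.
Proof.
move=> [k0 kc /is_derive0P kd] [l0 lc /is_derive0P ld] m0 mkl; split=> //.
  move=> A A1; have kA : \forall s \near (0 : R), A (k s) := kc A A1.
  have lA : \forall s \near (0 : R), A (l s) := lc A A1.
  have : \forall s \near (0 : R), A (m s); last exact.
  by apply: filterS3 mkl kA lA => s [->|->].
apply/is_derive0P => e e0; apply: filterS3 mkl (kd e e0) (ld e e0) => s.
by rewrite /= m0 k0 l0 => -[->|->].
Qed.

Hypothesis K_compact : compact [set: K].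

(** The semigroup on the half-line is extended to a group by writing [s] as a
    difference of nonnegative numbers. Its velocity is that of [k] for positive
    and of the inverse of [k(- s)] for negative times. *)
Lemma one_parameter_exists x : exists gamma, one_parameter c setT gamma x.
Proof.
have [P [P0 PD Pest]] := semigroup_exists c_atlas c_one K_compact x.
have PC (s u : R) : 0 <= s -> 0 <= u -> commute (P s) (P u).
  by move=> s0 u0; rewrite /commute -!PD// addrC.
pose gamma (s : R) := (P (Num.max s 0) * (P (Num.max (- s) 0))^-1)%g.
have gammaB (a b : R) : 0 <= a -> 0 <= b -> gamma (a - b) = (P a * (P b)^-1)%g.
  move=> a0 b0; have m0 : 0 <= Num.min a b by rewrite le_min a0.
  have aE : a = Num.max (a - b) 0 + Num.min a b.
    by have [h|h] := leP a b; [rewrite max_r|rewrite max_l]; lra.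
  have bE : b = Num.max (- (a - b)) 0 + Num.min a b.
    by have [h|h] := leP a b; [rewrite max_l|rewrite max_r]; lra.
  have Pa : P a = (P (Num.max (a - b) 0) * P (Num.min a b))%g.
    by rewrite {1}aE PD// le_max lexx orbT.
  have Pb : P b = (P (Num.max (- (a - b)) 0) * P (Num.min a b))%g.
    by rewrite {1}bE PD// le_max lexx orbT.
  by rewrite Pa Pb invgM mulgA mulgK.
have gammaE (s : R) : s = Num.max s 0 - Num.max (- s) 0.
  have [h|h] := leP 0 s.
    by rewrite ?(max_l h) (@max_r _ _ (- s) 0) ?oppr_le0// subr0.
  by rewrite ?(max_r (ltW h)) (@max_l _ _ (- s) 0) ?oppr_ge0 ?(ltW h)// sub0r opprK.
exists gamma; apply: one_parameter_of_velocity => // [s u|].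
  have s1 : 0 <= Num.max s 0 by rewrite le_max lexx orbT.
  have s2 : 0 <= Num.max (- s) 0 by rewrite le_max lexx orbT.
  have u1 : 0 <= Num.max u 0 by rewrite le_max lexx orbT.
  have u2 : 0 <= Num.max (- u) 0 by rewrite le_max lexx orbT.
  have -> : s + u = (Num.max s 0 + Num.max u 0) - (Num.max (- u) 0 + Num.max (- s) 0).
    by rewrite {1}(gammaE s) {1}(gammaE u); lra.
  rewrite gammaB ?addr_ge0// !PD// invgM /gamma.
  rewrite -!mulgA; congr (_ * _)%g; rewrite !mulgA; congr (_ * _)%g.
  by have /commuteV := PC _ _ u1 s2.
(* A curve in the chart that has velocity [x] on both sides and follows the
   semigroup on the right. *)
pose phi (s : R) := if 0 <= s then coord c (P s) else p1 + s *: x.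
have dphi : is_derive (0 : R^o) (1 : R^o) phi x.
  apply/is_derive0P => e e0; have [r r0 Pr] := Pest e e0.
  have : \forall s \near (0 : R), `|s| < r.
    by apply/nbhs_ballP; exists r => //= s; rewrite -ball_normE /ball_ /= sub0r normrN.
  apply: filterS => s sr; rewrite /phi lexx P0.
  have [s0|s0] := leP 0 s.
    have [_] : cdom c (P s) /\ `|coord c (P s) - p1 - s *: x| <= e * s.
      by apply: Pr; rewrite s0 -(ger0_norm s0).
    by rewrite (ger0_norm s0).
  by rewrite [p1 + _]addrC addrK subrr normr0 mulr_ge0// ltW.
have phi0 : phi 0 = p1 by rewrite /phi lexx P0.
have vA := velocity_of_coord c_one phi0 dphi.
have vB := velocity_inv c_atlas c_one (velocity_scale (-1) vA).
rewrite scaleN1r opprK in vB.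
apply: velocity_or vA vB _ _.
  by rewrite /gamma oppr0 maxxx mulgV.
have [r r0 Pr] := Pest 1 ltr01.
have : \forall s \near (0 : R), `|s| < r.
  by apply/nbhs_ballP; exists r => //= s; rewrite -ball_normE /ball_ /= sub0r normrN.
apply: filterS => s sr; have [s0|s0] := leP 0 s; [left|right].
  have [sD _] : cdom c (P s) /\ `|coord c (P s) - p1 - s *: x| <= 1 * s.
    by apply: Pr; rewrite s0 -(ger0_norm s0).
  rewrite /= /phi s0 coordK// /gamma.
  have -> : Num.max (- s) 0 = 0 by apply/max_idPr; rewrite oppr_le0.
  have -> : Num.max s 0 = s by apply/max_idPl.
  by rewrite P0 invg1 mulg1.
have ns0 : 0 <= - s by rewrite oppr_ge0 ltW.
have [sD _] : cdom c (P (- s)) /\ `|coord c (P (- s)) - p1 - (- s) *: x| <= 1 * - s.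
  by apply: Pr; rewrite ns0 -(ger0_norm ns0) normrN.
rewrite /= /phi mulN1r ns0 coordK// /gamma.
have -> : Num.max (- s) 0 = - s by apply/max_idPl.
have -> : Num.max s 0 = 0 by apply/max_idPr; rewrite ltW.
by rewrite P0 mul1g.
Qed.

(** The quotient of two one-parameter subgroups with the same velocity has
    derivative zero in the chart, because at every time it is a translate of a
    curve of velocity zero; so it stays at the identity. *)
Lemma one_parameter_unique (T T' : set K) k l x :
  one_parameter c T k x -> one_parameter c T' l x -> k = l.
Proof.
move=> kx lx; have k0 := one_parameter0 kx; have l0 := one_parameter0 lx.
have vk := one_parameter_velocity kx; have vl := one_parameter_velocity lx.
have [_ kD _ _] := kx; have [_ lD _ _] := lx.
pose q s := (k s * (l s)^-1)%g.
have := velocity_mul c_atlas c_one vk (velocity_inv c_atlas c_one vl).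
rewrite subrr -/q => vq; have [q0 qc _] := vq.
have dq s : cdom c (q s) -> is_derive (s : R^o) (1 : R^o) (coord c \o q) 0.
  move=> sD; apply: is_derive_shift0.
  have -> : (fun h : R => (coord c \o q) (s + h)) =
      (fun g => coord c (k s * g * (l s)^-1)%g) \o q.
    by apply/funext => h; rewrite /= /q kD lD invgM !mulgA.
  have tD : differentiable ((fun g => coord c (k s * g * (l s)^-1)%g) \o param c) p1.
    by apply: (translate_diff c_atlas c_atlas c_one); rewrite mulg1.
  have := velocity_fun c_one tD vq.
  by rewrite -[X in dif _ _ X](scale0r (0 : 'rV[R]_d)) difZ scale0r.
have : \forall s \near (0 : R), cdom c (q s) by apply: qc; exact: near_cdom.
move=> /nbhs_ballP[e /= e0 qe].
have {}qe s : `|s| < e -> cdom c (q s).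
  by move=> se; apply: qe; rewrite -ball_normE /ball_ /= sub0r normrN.
have small s : `|s| < e -> k s = l s.
  move=> se; apply: divg1_eq; rewrite -/(q s) -(coordK (qe s se)).
  have dq0 u : `|u| < e -> is_derive (u : R^o) (1 : R^o) (coord c \o q) 0.
    by move=> ue; apply: dq; exact: qe.
  have /= -> := zero_derive_cst_near dq0 se.
  by rewrite q0 coordK.
have pow (h : R -> K) n s : h 0 = 1%g -> (forall s u, h (s + u) = h s * h u)%g ->
    h (s *+ n) = (h s ^+ n)%g.
  by move=> h0 hD; elim: n => [|n IH]; rewrite ?mulr0n// mulrS hD IH expgS.
apply/funext => s.
have [n sn] : exists n : nat, `|s / n.+1%:R| < e.
  exists (Num.truncn (`|s| / e)); rewrite normrM normfV [`|_.+1%:R|]normr_nat.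
  by rewrite ltr_pdivrMr ?ltr0n// mulrC -ltr_pdivrMr// truncnS_gt.
have -> : s = (s / n.+1%:R) *+ n.+1 by rewrite -[RHS]mulr_natr divfK ?pnatr_eq0.
by rewrite !pow// small.
Qed.

Lemma one_parameter_Ad (T : set K) k x g : one_parameter c T k x ->
  one_parameter c setT (fun s => g * k s * g^-1)%g (x *m Ad c g).
Proof.
move=> kx; have [_ kD _ _] := kx; apply: one_parameter_of_velocity => //.
  by move=> s u; rewrite kD !mulgA mulgVK.
exact (velocity_conj c_atlas c_one g (one_parameter_velocity kx)).
Qed.

End OneParameter.

(** * Bounded one-parameter groups of matrices *)

Section ComplexRows.
Variables (R : realType) (m n : nat).
Implicit Types w : 'rV[R[i]]_m.

Lemma Re_mulmx_real w (X : 'M[R]_(m, n)) :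
  map_mx (@complex.Re R) (w *m map_mx (real_complex R) X) = map_mx (@complex.Re R) w *m X.
Proof.
apply/rowP => j; rewrite !mxE raddf_sum; apply: eq_bigr => k _; rewrite !mxE.
by case: (w 0 k) => x y /=; rewrite mulr0 subr0.
Qed.

Lemma Im_mulmx_real w (X : 'M[R]_(m, n)) :
  map_mx (@complex.Im R) (w *m map_mx (real_complex R) X) = map_mx (@complex.Im R) w *m X.
Proof.
apply/rowP => j; rewrite !mxE raddf_sum; apply: eq_bigr => k _; rewrite !mxE.
by case: (w 0 k) => x y /=; rewrite mulr0 add0r.
Qed.

Lemma rV_complex_neq0 w : w != 0 ->
  (map_mx (@complex.Re R) w != 0) || (map_mx (@complex.Im R) w != 0).
Proof.
apply: contra_neqT; rewrite negb_or !negbK => /andP[/eqP a0 /eqP b0].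
apply/rowP => j; have /rowP/(_ j) := a0; have /rowP/(_ j) := b0; rewrite !mxE.
by case: (w 0 j) => x y /= -> ->.
Qed.

End ComplexRows.

Section ComplexEigen.
Variables (R : realType) (n : nat) (w : 'rV[R[i]]_n) (X : 'M[R]_n) (l : R[i]).
Hypothesis wX : w *m map_mx (real_complex R) X = l *: w.
Local Notation a := (map_mx (@complex.Re R) w).
Local Notation b := (map_mx (@complex.Im R) w).

Lemma Re_eigen : a *m X = complex.Re l *: a - complex.Im l *: b.
Proof.
rewrite -Re_mulmx_real wX; apply/rowP => j; rewrite !mxE.
by case: (l) => x y; case: (w 0 j).
Qed.

Lemma Im_eigen : b *m X = complex.Re l *: b + complex.Im l *: a.
Proof.
rewrite -Im_mulmx_real wX; apply/rowP => j; rewrite !mxE.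
by case: (l) => x y; case: (w 0 j) => u v /=; rewrite [y * _]mulrC.
Qed.

End ComplexEigen.

Section BoundedGroups.
Variables (R : realType) (d : nat) (M : R -> 'M[R]_d) (A : 'M[R]_d) (B : R).
Hypotheses (M0 : M 0 = 1%:M) (MD : forall s u, M (s + u) = M s *m M u).
Hypotheses (dM : is_derive (0 : R^o) (1 : R^o) M A).
Hypotheses (M_bound : forall s i j, `|M s i j| <= B).

Lemma group_derive (w : 'rV[R]_d) s :
  is_derive (s : R^o) (1 : R^o) (fun t => w *m M t) (w *m A *m M s).
Proof.
apply: is_derive_shift0; under eq_fun do rewrite addrC MD mulmxA.
have := is_derive_mulmx_cst w (M s) dM; exact.
Qed.

Lemma row_bound (w : 'rV[R]_d) : exists C, forall s j, `|(w *m M s) 0 j| <= C.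
Proof.
exists (\sum_i `|w 0 i| * B) => s j; rewrite mxE.
apply: le_trans (ler_norm_sum _ _ _) _; apply: ler_sum => i _.
by rewrite normrM ler_wpM2l.
Qed.

(** If [w A^2 = 0] the orbit of [w] is the line [w + s (w A)]. *)
Lemma no_nilpotent (w : 'rV[R]_d) : w *m A *m A = 0 -> w *m A = 0.
Proof.
move=> wAA; have wAM s : w *m A *m M s = w *m A.
  rewrite -[RHS]mulmx1 -M0.
  apply: (zero_derive_cst (f := fun s => w *m A *m M s)) => u.
  by have := group_derive (w *m A) u; rewrite wAA mul0mx.
have wM s : w *m M s = w + s *: (w *m A).
  have : w *m M s - s *: (w *m A) = w *m M 0 - 0 *: (w *m A).
    apply: (zero_derive_cst (f := fun s => w *m M s - s *: (w *m A))) => u.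
    have /is_derive_eq := is_deriveB (group_derive w u) (is_derive_scale (w *m A) u).
    apply.
    by rewrite wAM subrr.
  by rewrite M0 mulmx1 scale0r subr0 => /eqP; rewrite subr_eq => /eqP.
have [C HC] := row_bound w; apply/rowP => j; rewrite [RHS]mxE; apply/eqP.
apply: contraT => wj; have := HC ((C + `|w 0 j| + 1) / (w *m A) 0 j) j.
rewrite wM mxE [X in _ + X]mxE divfK// => H.
have := ler_norm (w 0 j + (C + `|w 0 j| + 1)).
have := ler_norm (- w 0 j); rewrite normrN; lra.
Qed.

(** [a + i b] is a complex eigenvector of [A] for the eigenvalue
    [alpha + i beta]; a nonzero real part makes its orbit unbounded. *)
Lemma eigenvalue_imaginary (a b : 'rV[R]_d) alpha beta :
  (a != 0) || (b != 0) ->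
  a *m A = alpha *: a - beta *: b -> b *m A = alpha *: b + beta *: a -> alpha = 0.
Proof.
move=> ab0 aA bA.
pose h j s := ((a *m M s) 0 j) ^+ 2 + ((b *m M s) 0 j) ^+ 2.
have dh j s : is_derive (s : R^o) (1 : R^o) (h j) (2 * alpha * h j s).
  have /is_derive_mxP /(_ 0 j) da := group_derive a s.
  have /is_derive_mxP /(_ 0 j) db := group_derive b s.
  have /is_derive_eq := is_deriveD (is_deriveX 2 da) (is_deriveX 2 db); apply.
  rewrite aA bA mulmxBl mulmxDl -!scalemxAl /h.
  move: (a *m M s) (b *m M s) => u v; rewrite !mxE /GRing.scale /=; ring.
have hE j s : h j s = h j 0 * expR (2 * alpha * s).
  have : h j s * expR (- (2 * alpha * s)) = h j 0 * expR (- (2 * alpha * 0)).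
    apply: (@is_derive_0_is_cst R (fun s => h j s * expR (- (2 * alpha * s)))) => u.
    have de : is_derive (u : R^o) (1 : R^o) (fun s : R => expR (- (2 * alpha * s)) : R^o)
       (- (2 * alpha) * expR (- (2 * alpha * u))).
      have dl : is_derive (u : R^o) (1 : R^o) (fun s : R => - (2 * alpha * s) : R^o) (- (2 * alpha)).
        have := is_derive_scale (- (2 * alpha) : R^o) u.
        by under eq_fun do rewrite [_ *: _]mulrC mulNr.
      have /is_derive_eq := @is_derive1_comp R (@expR R) (fun s => - (2 * alpha * s)) u _ _ (is_derive_expR _) dl.
      by apply; rewrite mulrC.
    have /is_derive_eq := is_deriveM (dh j u) de; apply.
    by rewrite /GRing.scale /=; ring.
  rewrite mulr0 oppr0 expR0 mulr1 => <-.
  by rewrite -mulrA -expRD addNr expR0 mulr1.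
have [j hj] : exists j, 0 < h j 0.
  have [u [/rV0Pn[j uj] uE]] : exists u : 'rV[R]_d, u != 0 /\ (u = a \/ u = b).
    by case/orP: ab0 => ?; [exists a|exists b]; split => //; [left|right].
  exists j; rewrite /h M0 !mulmx1.
  have u2 : 0 < u 0 j ^+ 2 by rewrite exprn_even_gt0.
  have := sqr_ge0 (a 0 j); have := sqr_ge0 (b 0 j).
  by case: uE => uE; move: u2; rewrite uE; lra.
have [Ca HCa] := row_bound a; have [Cb HCb] := row_bound b.
have hB s : h j s <= Ca ^+ 2 + Cb ^+ 2.
  have sq (x C : R) : `|x| <= C -> x ^+ 2 <= C ^+ 2.
    move=> xC; have C0 := le_trans (normr_ge0 x) xC.
    by rewrite -(real_normK (num_real x)) lerXn2r.
  by rewrite lerD// sq.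
apply/eqP; apply: contraT => alpha0.
set C := Ca ^+ 2 + Cb ^+ 2 in hB.
have := hB (C / h j 0 / (2 * alpha)); rewrite hE mulrC.
rewrite [2 * alpha * _]mulrC divfK ?mulf_neq0// ?pnatr_eq0//.
have := expR_ge1Dx (C / h j 0); rewrite -(ler_pM2r hj) mulrDl divfK ?gt_eqF//; lra.
Qed.

Lemma nilpotent_eq0 k : (forall w : 'rV[R]_d, iter k (mulmxr A) w = 0) -> A = 0.
Proof.
elim: k => [|k IH] H; first by apply: mul_mx_ext => x; rewrite [x]H mul0mx mulmx0.
case: k IH H => [|k] IH H; first by apply: mul_mx_ext => x; rewrite mulmx0; exact: H.
by apply: IH => w; rewrite iterS; apply: no_nilpotent; exact: H.
Qed.

(** The generator of a bounded group has imaginary eigenvalues and no nilpotent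
    part, so that the trace of its square is a sum of nonpositive squares; if
    they vanish, the generator is nilpotent, hence zero. *)
Lemma bounded_group_trace : \tr (A *m A) <= 0 /\ (\tr (A *m A) = 0 -> A = 0).
Proof.
have [d0|d0] := posnP d.
  have -> : A = 0 by apply/matrixP => i; have := ltn_ord i; rewrite [X in (_ < X)%N]d0.
  by rewrite mul0mx mxtrace0.
pose AC : 'M[R[i]]_d := map_mx (real_complex R) A.
have [P Pu] := Schur AC d0.
have Punit := unitarymx_unit Pu.
rewrite /similar_to conjumx//; set S := P *m AC *m invmx P => Strig.
have Simag i : S i i = (0 +i* complex.Im (S i i))%C.
  have /eigenvalueP[v vS v0] : eigenvalue S (S i i).
    rewrite eigenvalue_root_char char_poly_trig// rootE horner_prod.
    by rewrite (bigD1 i)//= hornerXsubC subrr mul0r.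
  have vP0 : v *m P != 0.
    by apply: contra_neq v0 => vP; rewrite -[v](mulmxK Punit) vP mul0mx.
  have vPA : v *m P *m AC = S i i *: (v *m P).
    by rewrite scalemxAl -vS /S !mulmxA mulmxKV.
  have re0 := eigenvalue_imaginary (rV_complex_neq0 vP0) (Re_eigen vPA) (Im_eigen vPA).
  by case: (S i i) re0 => x y /= ->.
have trS : \tr (A *m A) = - \sum_i (complex.Im (S i i)) ^+ 2.
  apply: (@complexI R).
  have -> : (real_complex R) (\tr (A *m A)) = \tr (S *m S).
    have -> : S *m S = P *m (AC *m AC) *m invmx P.
      by rewrite /S !mulmxA mulmxKV.
    by rewrite [RHS]mxtrace_mulC mulmxA mulVmx// mul1mx -map_mxM trace_map_mx.
  rewrite raddfN raddf_sum /= /mxtrace -sumrN; apply: eq_bigr => i _.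
  rewrite mxE (bigD1 i)//= big1 ?addr0 => [|j ji].
    rewrite Simag; apply/eqP; rewrite eq_complex /=; apply/andP; split; apply/eqP; ring.
  have [lt|lt|/val_inj E] := ltngtP i j; last by rewrite E eqxx in ji.
    by rewrite (is_trig_mxP Strig)// mul0r.
  by rewrite mulrC (is_trig_mxP Strig)// mul0r.
have ge0 i : 0 <= (complex.Im (S i i)) ^+ 2 by exact: sqr_ge0.
split; first by rewrite trS oppr_le0 sumr_ge0.
rewrite trS => /eqP; rewrite oppr_eq0 psumr_eq0// => /allP S0.
have {}S0 i : S i i = 0.
  have := S0 i (mem_index_enum _); rewrite sqrf_eq0 => /eqP /= E.
  by rewrite Simag E.
have Sd : forall w : 'rV_d, iter d (mulmxr S) w = 0.
  have cS : char_poly S = 'X^d.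
    rewrite char_poly_trig// -[in RHS](card_ord d) -prodr_const.
    by apply: eq_bigr => i _; rewrite S0 subr0.
  move=> w; clear -cS d0; case: d d0 S cS w => // n _ S cS w.
  have iterE m : iter m (mulmxr S) w = w *m S ^+ m.
    elim: m => [|m IH]; first by rewrite expr0 mulmx1.
    by rewrite iterS IH /= exprSr mulmxA.
  rewrite iterE; have := Cayley_Hamilton S; rewrite cS rmorphXn /= horner_mx_X => Sn.
  by rewrite Sn mulmx0.
apply: (@nilpotent_eq0 d) => w.
pose wC : 'rV[R[i]]_d := map_mx (real_complex R) w.
have iterS_ k (u : 'rV[R[i]]_d) : iter k (mulmxr AC) u *m invmx P = iter k (mulmxr S) (u *m invmx P).
  elim: k => // k IH; rewrite !iterS /= -IH /S !mulmxA mulmxKV//.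
have : iter d (mulmxr AC) wC = 0.
  have := iterS_ d wC; rewrite Sd => /(congr1 (mulmxr P)) /=.
  by rewrite mulmxKV// mul0mx.
have mapE k : iter k (mulmxr AC) wC = map_mx (real_complex R) (iter k (mulmxr A) w).
  by elim: k => // k IH; rewrite !iterS /= map_mxM -IH.
rewrite mapE; by move=> /eqP; rewrite map_mx_eq0 => /eqP.
Qed.

End BoundedGroups.

(** * The Killing form of a compact semisimple group is definite *)

Section Definite.
Variables (R : realType) (d : nat) (K : topologicalGroupType).
Variables (L : lieGroup R d K) (c : chart R d K).
Hypotheses (c_atlas : atlas L c) (c_one : cdom c 1%g).
Hypothesis K_compact : compact [set: K].

(** [Ad] is bounded near the identity, hence by multiplicativity near every
    point, hence everywhere by compactness. *)
Lemma Ad_bounded : exists B, forall g i j, `|Ad c g i j| <= B.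
Proof.
have cAd : Ad c g @[g --> (1%g : K)] --> (1%:M : 'M[R]_d).
  have := differentiable_continuous (Ad_param_diff c_atlas c_one).
  rewrite /prop_for /continuous_at coordK// (Ad_one c_atlas c_one) => H.
  have H2 := cvg_comp _ _ (coord_continuous c_one) H.
  move=> A A1; have HA : \forall g \near (1%g : K), A (Ad c (param c (coord c g))) := H2 A A1.
  have : \forall g \near (1%g : K), A (Ad c g); last exact.
  apply: filterS2 (near_cdom c_one) HA => g gc.
  by rewrite coordK.
pose C := `|1%:M : 'M[R]_d| + 1.
have [U nU UC] : exists2 U : set K, nbhs (1%g : K) U & forall g, U g -> `|Ad c g| <= C.
  exists [set g | `|Ad c g| <= C] => //.
  have /cvgrPdist_le /(_ 1 ltr01) := cAd; apply: filterS => g gC.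
  rewrite /= -(subKr 1%:M (Ad c g)); apply: le_trans (ler_normB _ _) _.
  by rewrite lerD2l.
have /compact_near_coveringP cov := K_compact.
have := @cov R +oo (fun B g => `|Ad c g| <= B) _.
case.
  move=> g _.
  have near_g : \forall h \near g, `|Ad c h| <= d%:R * C * `|Ad c g|.
    have cg : (g^-1 * h)%g @[h --> g] --> (g^-1 * g)%g.
      by apply: mulg_cvg (cvg_id); exact: cvg_cst.
    have near2 : nbhs (g^-1 * g)%g U by rewrite mulVg.
    have H : \forall h \near g, U (g^-1 * h)%g by exact: cg U near2.
    apply: filterS H => h /UC hC.
    rewrite -[h](mulVKg g).
    rewrite (Ad_mul c_atlas c_one).
    apply: mx_norm_le => [|i j]; first by rewrite mulr_ge0// mulr_ge0// addr_ge0.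
    rewrite mxE; apply: le_trans (ler_norm_sum _ _ _) _.
    apply: (@le_trans _ _ (\sum_(k < d) C * `|Ad c g|)).
      apply: ler_sum => k _; rewrite normrM ler_pM//.
        exact: le_trans (mx_entry_le _ _ _) hC.
      exact: mx_entry_le.
    by rewrite sumr_const card_ord -[leLHS]mulr_natl mulrA.
  exists ([set h | `|Ad c h| <= d%:R * C * `|Ad c g|], [set B | d%:R * C * `|Ad c g| <= B]).
    split; [exact: near_g|exact: nbhs_pinfty_ge (num_real _)].
  by move=> [h B] /= [hB]; exact: le_trans.
move=> B [_ HB]; exists (B + 1) => g i j.
by apply: le_trans (mx_entry_le _ i j) _; apply: (HB (B + 1)) => //; rewrite ltrDl.
Qed.

Hypothesis K_semisimple : semisimple c.

(** [Ad] along the one-parameter subgroup of [x] is a bounded group of matrices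
    generated by [ad x], and an [x] with [ad x = 0] is orthogonal to
    everything. *)
Lemma kform_ge0 x : 0 <= kform c x x /\ (kform c x x = 0 -> x = 0).
Proof.
have [k kx] := one_parameter_exists c_atlas c_one K_compact x.
have [B HB] := Ad_bounded.
have [_ kD _ _] := kx; have k0 := one_parameter0 kx.
have M0 : Ad c (k 0) = 1%:M by rewrite k0 (Ad_one c_atlas c_one).
have MD s u : Ad c (k (s + u)) = Ad c (k s) *m Ad c (k u).
  by rewrite addrC kD (Ad_mul c_atlas c_one).
have dM := velocity_Ad c_atlas c_one (one_parameter_velocity kx).
have [tr0 tr1] := @bounded_group_trace R d (Ad c \o k) (ad c x) B M0 MD dM (fun s => HB (k s)).
rewrite /kform /killing oppr_ge0; split => // /eqP; rewrite oppr_eq0 => /eqP /tr1 adx.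
by apply: K_semisimple => y; rewrite /killing adx mul0mx mxtrace0.
Qed.

End Definite.

(** * Maximal tori *)

Section ClosureOfSubgroup.
Variables (K : topologicalGroupType) (H : set K).
Hypothesis K_hausdorff : hausdorff_space K.
Hypotheses (H1 : H 1%g) (Hdiv : forall g h, H g -> H h -> H (g * h^-1)%g).
Hypothesis Hcomm : forall g h, H g -> H h -> (g * h = h * g)%g.

(** Continuous maps in two variables send the closure into the closure. *)
Lemma closure_pick (f : K * K -> K) x y B : {for (x, y), continuous f} ->
  closure H x -> closure H y -> nbhs (f (x, y)) B ->
  exists g h, [/\ H g, H h & B (f (g, h))].
Proof.
move=> cf Hx Hy HB; have [[A1 A2] /= [nA1 nA2] AB] := cf _ HB.
have [g [Hg Ag]] := Hx _ nA1; have [h [Hh Ah]] := Hy _ nA2.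
by exists g, h; split => //; exact: (AB (g, h)).
Qed.

Lemma closure_subgroup : let S := closure H in
  [/\ S 1%g, forall g h, S g -> S h -> S (g * h^-1)%g
    & forall g h, S g -> S h -> (g * h = h * g)%g].
Proof.
have cdiv x y : {for (x, y), continuous (fun z : K * K => (z.1 * z.2^-1)%g)}.
  by apply: mulg_cvg; [exact: cvg_fst|apply: invg_cvg; exact: cvg_snd].
have cmul x y : {for (x, y), continuous (fun z : K * K => (z.1 * z.2)%g)}.
  exact: mulg_continuous.
have cmul' x y : {for (x, y), continuous (fun z : K * K => (z.2 * z.1)%g)}.
  by apply: mulg_cvg; [exact: cvg_snd|exact: cvg_fst].
split; first exact: subset_closure.
  move=> x y Sx Sy B HB; have [g [h [Hg Hh Bgh]]] := closure_pick (cdiv x y) Sx Sy HB.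
  by exists (g * h^-1)%g; split => //; exact: Hdiv.
move=> x y Sx Sy; apply: K_hausdorff => A B HA HB.
have nE : nbhs (x, y) ((fun z : K * K => (z.1 * z.2)%g) @^-1` A `&`
    (fun z : K * K => (z.2 * z.1)%g) @^-1` B).
  by apply: filterI; [exact: cmul HA|exact: cmul' HB].
have [[A1 A2] /= [nA1 nA2] AB] := nE.
have [g [Hg Ag]] := Sx _ nA1; have [h [Hh Ah]] := Sy _ nA2.
have [/= Agh Bhg] := AB (g, h) (conj Ag Ah).
by exists (g * h)%g; split => //; rewrite Hcomm.
Qed.

End ClosureOfSubgroup.

Section MaximalTorus.
Variables (R : realType) (d : nat) (K : topologicalGroupType).
Variables (L : lieGroup R d K) (c : chart R d K).
Hypotheses (c_atlas : atlas L c) (c_one : cdom c 1%g).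
Hypothesis K_compact : compact [set: K].
Variable T : set K.
Hypothesis T_max : maximal_torus T.

Lemma torus_invg g : T g -> T (g^-1)%g.
Proof. by move=> Tg; have [[T1 Td _ _ _] _] := T_max; rewrite -(mul1g g^-1%g); exact: Td. Qed.

Lemma torus_mulg g h : T g -> T h -> T (g * h)%g.
Proof.
move=> Tg Th; have [[T1 Td _ _ _] _] := T_max; rewrite -[h]invgK.
by apply: Td => //; exact: torus_invg.
Qed.

Lemma torus_commute g h : T g -> T h -> (g * h = h * g)%g.
Proof. by have [[_ _ Tc _ _] _] := T_max; exact: Tc. Qed.

Lemma torus_one : T 1%g. Proof. by have [[]] := T_max. Qed.

Lemma torus_lie0 : torus_lie c T 0.
Proof.
exists (fun=> 1%g); apply: one_parameter_of_velocity; last exact: velocity_cst.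
  by move=> s u; rewrite mulg1.
by move=> s; exact: torus_one.
Qed.

(** Products of commuting one-parameter subgroups are one-parameter subgroups. *)
Lemma torus_lieP a x y : torus_lie c T x -> torus_lie c T y -> torus_lie c T (a *: x + y).
Proof.
move=> [k kx] [l ly]; have [_ kD kT _] := kx; have [_ lD lT _] := ly.
exists (fun s => (k (a * s)%R * l s)%g); apply: one_parameter_of_velocity.
- move=> s u; rewrite mulrDr kD lD !mulgA; congr (_ * _)%g.
  by rewrite -!mulgA; congr (_ * _)%g; exact: torus_commute.
- by move=> s; apply: torus_mulg.
apply: (velocity_mul c_atlas c_one); last exact: one_parameter_velocity ly.
exact: velocity_scale (one_parameter_velocity kx).
Qed.

(** The closure of the group generated by [T] and a one-parameter subgroup
    commuting with it is again a torus, hence is [T]. *)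
Lemma torus_lie_centralizer z : (forall g, T g -> z *m Ad c g = z) -> torus_lie c T z.
Proof.
move=> zT; have [k kz] := one_parameter_exists c_atlas c_one K_compact z.
have [kc kD _ kd] := kz; have k0 := one_parameter0 kz.
have kT g s : T g -> (g * k s = k s * g)%g.
  move=> Tg; have kg := one_parameter_Ad c_atlas c_one g kz; rewrite zT// in kg.
  have /(congr1 (fun f => f s)) /= E := one_parameter_unique c_atlas c_one kg kz.
  by rewrite -{2}E mulgVK.
have kk s u : (k s * k u = k u * k s)%g by rewrite -!kD addrC.
pose H := [set h | exists g s, T g /\ h = (g * k s)%g].
have TH : T `<=` H by move=> g Tg; exists g, 0; rewrite k0 mulg1.
have kH s : H (k s) by exists 1%g, s; rewrite mul1g; split => //; exact: torus_one.
have Hdiv g h : H g -> H h -> H (g * h^-1)%g.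
  move=> [g' [s [Tg ->]]] [h' [u [Th ->]]].
  exists (g' * h'^-1)%g, (s - u); split; first by have [[_ Td _ _ _] _] := T_max; exact: Td.
  rewrite -[RHS]mulgA (kT _ _ (torus_invg Th)).
  by rewrite kD (one_parameterN _ kz) invgM !mulgA.
have Hcomm g h : H g -> H h -> (g * h = h * g)%g.
  move=> [g' [s [Tg ->]]] [h' [u [Th ->]]].
  rewrite -!mulgA (mulgA (k s)) -kT// (mulgA (k u)) -kT// !mulgA (torus_commute Tg Th).
  by rewrite -!mulgA kk.
have [S1 Sdiv Scomm] := closure_subgroup (lie_hausdorff L) (TH _ torus_one) Hdiv Hcomm.
have Hconn : connected H.
  have -> : H = \bigcup_(g in T) (T `|` [set (g * k s)%g | s in [set: R]]).
    apply/seteqP; split => [_ [g [s [Tg ->]]]|h [g Tg [Th|[s _ <-]]]].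
    - by exists g => //; right; exists s.
    - exact: TH.
    - by exists g, s.
  apply: bigcup_connected; first by exists 1%g => g Tg; left; exact: torus_one.
  move=> g Tg; apply: connectedU.
  - by exists g; split => //; exists 0 => //; rewrite k0 mulg1.
  - by have [[]] := T_max.
  - apply: connected_continuous_connected; first exact/connected_intervalP.
    apply: continuous_subspaceT => s; apply: mulg_cvg; first exact: cvg_cst.
    exact: kc.
have ST : closure H = T.
  have [_] := T_max; apply; last by move=> g Tg; apply: subset_closure; exact: TH.
  split => //; last exact: connected_closure.
  apply: (subclosed_compact _ K_compact) => //; exact: closed_closure.
exists k; apply: one_parameter_of_velocity; [exact: kD| |exact: one_parameter_velocity kz].
by move=> s; rewrite -ST; apply: subset_closure.
Qed.

End MaximalTorus.

(** * Linear algebra of subspaces *)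

Section Subspaces.
Variables (F : fieldType) (d : nat).

(** A subspace of maximal dimension inside [S] exhausts [S]. *)
Lemma subspace_mx (S : set 'rV[F]_d) : S 0 ->
  (forall a x y, S x -> S y -> S (a *: x + y)) ->
  exists U : 'M[F]_d, forall x, S x <-> (x <= U)%MS.
Proof.
move=> S0 SP.
pose P r := `[< exists2 U : 'M[F]_d, \rank U = r & forall x, (x <= U)%MS -> S x >].
have P0 : exists r, P r.
  exists 0%N; apply/asboolP; exists 0; first by rewrite mxrank0.
  by move=> x; rewrite submx0 => /eqP ->.
have Pd r : P r -> (r <= d)%N by move=> /asboolP[U <- _]; exact: rank_leq_row.
have [r /asboolP[U Ur US] rmax] := ex_maxnP P0 Pd.
exists U => x; split; last exact: US.
move=> Sx; apply: contraT => xU.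
have /rmax : P (\rank (U + x)%MS).
  apply/asboolP; exists (U + x)%MS => // y /sub_addsmxP[[u v] /= ->].
  rewrite addrC (mx11_scalar v) mul_scalar_mx; apply: SP => //.
  by apply: US; exact: submxMl.
rewrite leqNgt -Ur => /negP[]; apply: rank_ltmx; rewrite /ltmx addsmxSl /=.
by apply: contra xU; apply: submx_trans; exact: addsmxSr.
Qed.

End Subspaces.

(** A minimal nonzero subspace stable under a commuting family consists of
    common eigenvectors, as the eigenspaces of each member are stable. *)
Lemma common_eigenvector_set (C : numClosedFieldType) n (F : set 'M[C]_n)
    (m : nat) (V : 'M[C]_(m, n)) :
  (forall A B, F A -> F B -> A *m B = B *m A) ->
  (forall A, F A -> (V *m A <= V)%MS) -> V != 0 ->
  exists w : 'rV[C]_n, [/\ w != 0, (w <= V)%MS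
    & forall A, F A -> exists l, w *m A = l *: w].
Proof.
move=> Fcomm; have [r] := ubnP (\rank V); elim: r m V => // r IH m V Vr Vstab V0.
have [scal|] := pselect (forall A, F A -> exists l, V *m A = l *: V).
  have /rowV0Pn[w wV w0] := V0; exists w; split => // A FA.
  have [l Vl] := scal A FA; exists l; have /submxP[u ->] := wV.
  by rewrite -mulmxA Vl scalemxAr.
move=> /existsNP[A /not_implyP[FA nscal]].
pose B := row_base V; have BV : (B :=: V)%MS := eq_row_base V.
pose A' := B *m A *m pinvmx B.
have BA : A' *m B = B *m A.
  by rewrite /A' mulmxKpV// (eqmxMr _ BV) BV; exact: Vstab.
have rV : (0 < \rank V)%N by rewrite lt0n mxrank_eq0.
have [l /eigenvalueP[u uA u0]] := eigenvalue_closed A' rV.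
pose E := (V :&: kermx (A - l%:M))%MS.
have EA (x : 'rV_n) : (x <= E)%MS = (x <= V)%MS && (x *m A == l *: x).
  rewrite sub_capmx; congr (_ && _); rewrite (sameP sub_kermxP eqP).
  by rewrite mulmxBr mul_mx_scalar subr_eq0.
have E0 : E != 0.
  have uB : (u *m B <= E)%MS.
    rewrite EA -BV submxMl /= -mulmxA -BA mulmxA uA.
    by rewrite scalemxAl.
  apply: contraNneq u0 => E0; move: uB; rewrite E0 submx0 => /eqP uB.
  by apply/eqP; apply: (row_free_inj (row_base_free V)); rewrite uB mul0mx.
have EV : (E <= V)%MS := capmxSl _ _.
have [w [w0 wE wF]] : exists w : 'rV[C]_n, [/\ w != 0, (w <= E)%MS
    & forall A, F A -> exists l, w *m A = l *: w].
  apply: IH => //.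
    apply: leq_trans (_ : \rank V <= r)%N; last by [].
    apply: rank_ltmx; rewrite /ltmx EV /=; apply/negP => VE.
    apply: nscal; exists l; apply/row_matrixP => i; rewrite row_mul linearZ /=.
    have := submx_trans (row_sub i V) VE; rewrite EA => /andP[_ /eqP].
    by [].
  move=> X FX; apply/row_subP => i; rewrite row_mul.
  have := row_sub i E; rewrite !EA => /andP[iV /eqP iA]; apply/andP; split.
    exact: submx_trans (submxMr _ iV) (Vstab _ FX).
  by rewrite -mulmxA -(Fcomm _ _ FA FX) mulmxA iA scalemxAl.
by exists w; split => //; exact: submx_trans wE EV.
Qed.

Section Projection.
Variables (R : realType) (d : nat) (K : topologicalGroupType).
Variables (L : lieGroup R d K) (c : chart R d K).
Hypotheses (c_atlas : atlas L c) (c_one : cdom c 1%g).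
Hypothesis K_compact : compact [set: K].
Hypothesis K_semisimple : semisimple c.

(** Orthogonal projection for the definite form [kform]. *)
Lemma kform_projection (S : set 'rV[R]_d) (y : 'rV[R]_d) : S 0 ->
  (forall a x y, S x -> S y -> S (a *: x + y)) ->
  exists2 z, S z & forall x, S x -> kform c z x = kform c y x.
Proof.
move=> S0 SP; have [U0 US0] := subspace_mx S0 SP.
pose U := row_base U0.
have US x : S x <-> (x <= U)%MS by rewrite US0 (eq_row_base U0).
have Ufree : row_free U := row_base_free U0.
clearbody U; pose G := U *m kgram c *m U^T.
have Gunit : G \in unitmx.
  rewrite -row_free_unit -kermx_eq0; apply/rowV0P => x /sub_kermxP xG.
  have [_ xU0] := kform_ge0 c_atlas c_one K_compact K_semisimple (x *m U).
  apply: (row_free_inj Ufree); rewrite mul0mx; apply: xU0.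
  rewrite (kformE c_atlas c_one) trmx_mul !mulmxA.
  have := congr1 (fun Y => (Y *m x^T) 0 0) xG; rewrite /G !mulmxA => ->.
  by rewrite mul0mx mxE.
exists (y *m kgram c *m U^T *m invmx G *m U); first by apply/US; exact: submxMl.
move=> x /US /submxP[u ->]; rewrite !(kformE c_atlas c_one) trmx_mul.
have yG := mulmxKV Gunit (y *m kgram c *m U^T); rewrite {2}/G in yG.
by rewrite !mulmxA in yG *; rewrite yG.
Qed.

End Projection.

(** * Regular elements of the torus *)

Section Roots.
Variables (R : realType) (d : nat) (K : topologicalGroupType).
Variables (L : lieGroup R d K) (c : chart R d K).
Hypotheses (c_atlas : atlas L c) (c_one : cdom c 1%g).
Hypothesis K_compact : compact [set: K].
Hypothesis K_semisimple : semisimple c.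
Variable T : set K.
Hypothesis T_max : maximal_torus T.

Local Notation rc := (real_complex R).

(** The pair [(u, v)] is the product of [a + i b] by [r + i t]. *)
Lemma kform_rotation (r t : R) (a b : 'rV[R]_d) :
  let u := r *: a - t *: b in let v := r *: b + t *: a in
  kform c u u + kform c v v = (r ^+ 2 + t ^+ 2) * (kform c a a + kform c b b).
Proof.
have := kformPl c_atlas c_one; have := kformC c.
move: (kform c) => Q QC QP /=.
have Q0 z : Q 0 z = 0.
  by have := QP (-1) 0 0 z; rewrite scaler0 addr0 => ->; rewrite mulN1r addNr.
have QZ e x z : Q (e *: x) z = e * Q x z.
  by have := QP e x 0 z; rewrite Q0 !addr0.
have E1 e1 e2 x y : Q (e1 *: x + e2 *: y) (e1 *: x + e2 *: y) =
    e1 ^+ 2 * Q x x + 2 * e1 * e2 * Q x y + e2 ^+ 2 * Q y y.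
  rewrite QP QZ (QC x) (QC y) !QP !QZ (QC y x); ring.
by rewrite -scaleNr !E1 (QC b a); ring.
Qed.

(** The eigenvalues of [T] on [w] form a character [chi], of modulus one since
    [Ad] preserves the definite form [kform]. Its derivative at the identity is
    thus an imaginary linear form, and projecting the vector that represents
    this form to the Lie algebra of [T] gives the root. It vanishes on the [x]
    whose one-parameter subgroup fixes [w], since [chi] is then constant. *)
Lemma root_of_eigenvector (w : 'rV[R[i]]_d) : w != 0 ->
  (forall g, T g -> exists l, w *m map_mx rc (Ad c g) = l *: w) ->
  (exists2 g, T g & w *m map_mx rc (Ad c g) != w) ->
  exists2 alpha, roots c T alpha & forall k x, one_parameter c T k x ->
    (forall s, w *m map_mx rc (Ad c (k s)) = w) -> pairing alpha x = 0.
Proof.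
move=> w0 wT [g1 Tg1 wg1]; have [j wj] := rV0Pn _ w0.
pose chi g := (w *m map_mx rc (Ad c g)) 0 j / w 0 j.
have chiE g : T g -> w *m map_mx rc (Ad c g) = chi g *: w.
  by move=> Tg; have [l wl] := wT g Tg; rewrite /chi wl mxE mulfK.
have chi1 : chi 1%g = 1.
  by rewrite /chi (Ad_one c_atlas c_one) map_mx1 mulmx1 divff.
set a := map_mx (@complex.Re R) w; set b := map_mx (@complex.Im R) w.
have ab0 : (a != 0) || (b != 0) := rV_complex_neq0 w0.
pose p := complex.Re (w 0 j)^-1; pose q := complex.Im (w 0 j)^-1.
have chiRe g : complex.Re (chi g) = (a *m Ad c g) 0 j * p - (b *m Ad c g) 0 j * q.
  rewrite /chi -(Re_mulmx_real w (Ad c g)) -(Im_mulmx_real w (Ad c g)) !mxE /p /q.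
  by case: ((w 0 j)^-1) => ? ?; case: (\sum_(_ < _) _).
have chiIm g : complex.Im (chi g) = (a *m Ad c g) 0 j * q + (b *m Ad c g) 0 j * p.
  rewrite /chi -(Re_mulmx_real w (Ad c g)) -(Im_mulmx_real w (Ad c g)) !mxE /p /q.
  by case: ((w 0 j)^-1) => ? ?; case: (\sum_(_ < _) _).
pose lRe x := (a *m ad c x) 0 j * p - (b *m ad c x) 0 j * q.
pose lIm x := (a *m ad c x) 0 j * q + (b *m ad c x) 0 j * p.
have dM k x (u : 'rV[R]_d) : one_parameter c T k x ->
    is_derive (0 : R^o) (1 : R^o) (fun s => (u *m Ad c (k s)) 0 j : R^o) ((u *m ad c x) 0 j).
  move=> kx; have dAd := velocity_Ad c_atlas c_one (one_parameter_velocity kx).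
  have := is_derive_mulmx_cst u 1%:M dAd; rewrite mulmx1 => /is_derive_mxP /(_ 0 j).
  by under eq_fun do rewrite mulmx1.
have dRe k x : one_parameter c T k x ->
    is_derive (0 : R^o) (1 : R^o) (fun s => complex.Re (chi (k s)) : R^o) (lRe x).
  move=> kx; under eq_fun do rewrite chiRe mulrC [X in _ - X]mulrC.
  rewrite /lRe mulrC [X in _ - X]mulrC.
  exact: (is_deriveB (is_deriveZ p (dM k x a kx)) (is_deriveZ q (dM k x b kx))).
have dIm k x : one_parameter c T k x ->
    is_derive (0 : R^o) (1 : R^o) (fun s => complex.Im (chi (k s)) : R^o) (lIm x).
  move=> kx; under eq_fun do rewrite chiIm mulrC [X in _ + X]mulrC.
  rewrite /lIm mulrC [X in _ + X]mulrC.
  exact: (is_deriveD (is_deriveZ q (dM k x a kx)) (is_deriveZ p (dM k x b kx))).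
have chi_norm g : T g -> complex.Re (chi g) ^+ 2 + complex.Im (chi g) ^+ 2 = 1.
  move=> Tg; have wE := chiE g Tg.
  have aE := Re_eigen wE; have bE := Im_eigen wE; rewrite -/a -/b in aE bE.
  have := kform_rotation (complex.Re (chi g)) (complex.Im (chi g)) a b.
  rewrite /= -aE -bE !(kform_Ad c_atlas c_one).
  have H0 : 0 < kform c a a + kform c b b.
    move: (kform_ge0 c_atlas c_one K_compact K_semisimple a).
    move: (kform_ge0 c_atlas c_one K_compact K_semisimple b).
    move: (kform c a a) (kform c b b) => A B [B0 bN] [A0 aN].
    rewrite lt_def addr_ge0// andbT paddr_eq0//.
    by apply: contraTN ab0 => /andP[/eqP /aN -> /eqP /bN ->]; rewrite eqxx.
  move: (kform c a a + kform c b b) H0 => H H0 /esym.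
  by rewrite -{2}[H]mul1r => /(mulIf (lt0r_neq0 H0)).
have lRe0 k x : one_parameter c T k x -> lRe x = 0.
  move=> kx; have k0 := one_parameter0 kx; have [_ _ kT _] := kx.
  have := is_deriveD (is_deriveX 2 (dRe k x kx)) (is_deriveX 2 (dIm k x kx)).
  have -> : (fun s => complex.Re (chi (k s)) : R^o) ^+ 2 + (fun s => complex.Im (chi (k s)) : R^o) ^+ 2 = cst 1.
    by apply/funext => s; rewrite -[RHS](chi_norm (k s))//.
  move=> /is_derive_unique /(_ (is_derive_cst _ _ _)).
  rewrite k0 chi1 /= /GRing.scale /=; lra.
have [y yE] : exists y, forall x, kform c y x = lIm x.
  exists (sharp c (\row_i lIm (delta_mx 0 i))) => x.
  rewrite (kform_sharp c_atlas c_one K_semisimple); apply: linear_pairing.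
  move=> e u v; rewrite /lIm (adP c_atlas c_one); move: (ad c u) (ad c v) => X Y.
  by rewrite !mulmxDr -!scalemxAr !mxE; ring.
have [z zT zE] := kform_projection c_atlas c_one K_compact K_semisimple y
  (torus_lie0 c T_max) (torus_lieP c_atlas c_one T_max).
exists (flat c z).
  exists chi; split.
  - exists w^T; first by rewrite trmx_eq0.
    move=> g Tg; rewrite /AdC -[map_mx _ _](map_trmx rc) -trmx_mul chiE//.
    by rewrite linearZ.
  - exists g1 => //; apply: contra wg1 => /eqP chi1'.
    by rewrite chiE// chi1' scale1r.
  split; first by exists z.
  move=> k x kx; rewrite (pairing_flat c_atlas c_one) zE; last by exists k.
  rewrite yE; split; last exact: dIm.
  by have := dRe k x kx; rewrite (lRe0 k x kx).
move=> k x kx kw; rewrite (pairing_flat c_atlas c_one) zE; last by exists k.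
rewrite yE; apply: is_derive_unique (dIm k x kx) _.
have -> : (fun s => complex.Im (chi (k s)) : R^o) = cst 0.
  by apply/funext => s; rewrite /chi kw divff.
exact: is_derive_cst.
Qed.

(** Regularity means that no root vanishes on [x0]: the elements of the Lie
    algebra that commute with [x0] are fixed by the whole torus. Otherwise, the
    complexified orthogonal complement of the fixed ones would contain a common
    eigenvector of [T], and with it a root vanishing on [x0]. *)
Lemma regular_fixed k (x0 nu : 'rV[R]_d) : one_parameter c T k x0 -> regular c T (flat c x0) ->
  (forall s, nu *m Ad c (k s) = nu) -> forall g, T g -> nu *m Ad c g = nu.
Proof.
move=> kx reg; have [_ _ kT _] := kx.
have dual alpha : dual_form c (flat c x0) alpha = pairing alpha x0.
  rewrite /dual_form (flatK c_atlas c_one K_semisimple) kformC.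
  by rewrite (kform_sharp c_atlas c_one K_semisimple).
have := root_of_eigenvector.
have := @kform_projection _ _ _ _ _ c_atlas c_one K_compact K_semisimple.
have := kformPl c_atlas c_one; have := kformC c; have := kform_Ad c_atlas c_one.
have := kform_ge0 c_atlas c_one K_compact K_semisimple.
have := Ad_mul c_atlas c_one.
(* From here on only these properties of [kform] and [Ad] are used. *)
move: (kform c) (Ad c) => Q A AM Qpos QA QC QP proj rootE nuk.
pose Z (z : 'rV[R]_d) := forall g, T g -> z *m A g = z.
have Z0 : Z 0 by move=> g _; rewrite mul0mx.
have ZP e x y : Z x -> Z y -> Z (e *: x + y).
  by move=> Zx Zy g Tg; rewrite mulmxDl -scalemxAl Zx// Zy.
have [z Zz zE] := proj Z nu Z0 ZP.
have Q0 x : Q 0 x = 0.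
  by have := QP (-1) 0 0 x; rewrite scaler0 addr0 => ->; rewrite mulN1r addNr.
pose V v := (forall s, v *m A (k s) = v) /\ (forall u, Z u -> Q v u = 0).
have V0 : V 0 by split => [s|u _]; rewrite ?mul0mx ?Q0.
have VP e x y : V x -> V y -> V (e *: x + y).
  move=> [xk xZ] [yk yZ]; split => [s|u Zu].
    by rewrite mulmxDl -scalemxAl (xk s) (yk s).
  by rewrite QP xZ// yZ// mulr0 addr0.
have VT v g : T g -> V v -> V (v *m A g).
  move=> Tg [vk vZ]; split => [s|u Zu].
    rewrite -(mulmxA v (A g)) -AM (torus_commute T_max (kT s) Tg).
    by rewrite AM (mulmxA v (A (k s))) (vk s).
  by rewrite -(Zu g Tg) QA (vZ u Zu).
have Vnu : V (nu - z).
  split=> [s|u Zu].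
    by rewrite mulmxBl (nuk s) (Zz _ (kT s)).
  by rewrite -[nu]scale1r QP -scaleN1r -[-1 *: z]addr0 QP Q0 zE//; ring.
suff V_eq0 v : V v -> v = 0.
  move=> g Tg; have /eqP := V_eq0 _ Vnu; rewrite subr_eq0 => /eqP ->; exact: Zz.
have [U UV] := subspace_mx V0 VP.
move=> Vv; apply/eqP; apply: contraT => v0.
have U0 : U != 0.
  by apply: contraNneq v0 => U0; have /UV := Vv; rewrite U0 submx0.
have rowU i : V (row i U) by apply/UV; exact: row_sub.
pose UC := map_mx rc U.
have UC0 : UC != 0 by rewrite map_mx_eq0.
pose F := [set map_mx rc (A g) | g in T].
have [w [w0 wU wF]] : exists w : 'rV_d, [/\ w != 0, (w <= UC)%MS
    & forall A, F A -> exists l, w *m A = l *: w].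
  apply: common_eigenvector_set => //.
    move=> _ _ [g Tg <-] [h Th <-]; rewrite -!map_mxM -!AM.
    by rewrite (torus_commute T_max Tg Th).
  move=> _ [g Tg <-]; rewrite -map_mxM map_submx; apply/row_subP => i.
  by rewrite row_mul; apply/UV; apply: VT.
have [u wE] := submxP wU.
have wV (f : R[i] -> R) : f = @complex.Re R \/ f = @complex.Im R -> V (map_mx f w).
  by move=> fE; apply/UV; rewrite wE; case: fE => ->; rewrite ?Re_mulmx_real ?Im_mulmx_real submxMl.
have wk s : w *m map_mx rc (A (k s)) = w.
  rewrite wE -mulmxA -map_mxM; congr (_ *m map_mx rc _).
  by apply/row_matrixP => i; rewrite row_mul; have [] := rowU i.
have [||alpha ralpha alpha0] := rootE w w0.
- by move=> g Tg; apply: wF; exists g.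
- have [nfix|] := pselect (exists2 g, T g & w *m map_mx rc (A g) != w); first exact: nfix.
  move=> /forall2NP fix_; exfalso; move/negP: w0; apply.
  have wfix g : T g -> w *m map_mx rc (A g) = w.
    by move=> Tg; have [|/negP] := fix_ g; rewrite ?negbK => // /eqP.
  have f0 (f : R[i] -> R) : f = @complex.Re R \/ f = @complex.Im R -> map_mx f w = 0.
    move=> fE; have [_ fZ] := wV f fE; have [_] := Qpos (map_mx f w); apply; apply: fZ.
    by move=> g Tg; rewrite -{2}(wfix g Tg); case: fE => ->; rewrite ?Re_mulmx_real ?Im_mulmx_real.
  apply: contraT => /rV_complex_neq0; rewrite f0 ?eqxx /=; last by left.
  by rewrite f0 ?eqxx//; right.
by have := reg alpha ralpha; rewrite dual (alpha0 k x0 kx wk) eqxx.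
Qed.

End Roots.

(** * Unitary representations *)

Section ComplexCurves.
Variable R : realType.
Local Notation C := R[i].
Local Notation Rem := (map_mx (@complex.Re R)).
Local Notation Imm := (map_mx (@complex.Im R)).

(** The conjugate transpose for the conjugation by which [hermitian] is
    defined. *)
Definition adjmx m n (A : 'M[C]_(m, n)) : 'M[C]_(n, m) := (map_mx (@conjc R) A)^T.

Lemma adjmx_mul m n p (A : 'M[C]_(m, n)) (B : 'M[C]_(n, p)) :
  adjmx (A *m B) = adjmx B *m adjmx A.
Proof. by rewrite /adjmx map_mxM trmx_mul. Qed.

Lemma adjmxK m n (A : 'M[C]_(m, n)) : adjmx (adjmx A) = A.
Proof. by apply/matrixP => i j; rewrite !mxE conjcK. Qed.

Lemma adjmxZ m n (a : C) (A : 'M[C]_(m, n)) : adjmx (a *: A) = a^*%C *: adjmx A.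
Proof. by apply/matrixP => i j; rewrite !mxE rmorphM. Qed.

Lemma hermitianE n (v w : 'cV[C]_n) : hermitian v w = (adjmx w *m v) 0 0.
Proof. by rewrite mxE; apply: eq_bigr => j _; rewrite !mxE mulrC. Qed.

Lemma unitary_adj n (A : 'M[C]_n) : A \is unitarymx -> A *m adjmx A = 1%:M.
Proof.
by move=> /unitarymxP <-; congr (_ *m _); apply/matrixP => i j; rewrite !mxE.
Qed.

Definition cderive m n (F : R -> 'M[C]_(m, n)) (s : R) (X : 'M[C]_(m, n)) : Prop :=
  is_derive (s : R^o) (1 : R^o) (fun t => Rem (F t)) (Rem X) /\
  is_derive (s : R^o) (1 : R^o) (fun t => Imm (F t)) (Imm X).

Lemma cderiveP m n (F : R -> 'M[C]_(m, n)) s X :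
  cderive F s X <-> forall i j,
    is_derive (s : R^o) (1 : R^o) (fun t => complex.Re (F t i j) : R^o) (complex.Re (X i j)) /\
    is_derive (s : R^o) (1 : R^o) (fun t => complex.Im (F t i j) : R^o) (complex.Im (X i j)).
Proof.
have RE : (forall i j, is_derive (s : R^o) (1 : R^o) (fun t => Rem (F t) i j : R^o) (Rem X i j)) <->
    forall i j, is_derive (s : R^o) (1 : R^o) (fun t => complex.Re (F t i j) : R^o) (complex.Re (X i j)).
  by split => H i j; [have := H i j|]; rewrite mxE; under eq_fun do rewrite mxE.
have IE : (forall i j, is_derive (s : R^o) (1 : R^o) (fun t => Imm (F t) i j : R^o) (Imm X i j)) <->
    forall i j, is_derive (s : R^o) (1 : R^o) (fun t => complex.Im (F t i j) : R^o) (complex.Im (X i j)).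
  by split => H i j; [have := H i j|]; rewrite mxE; under eq_fun do rewrite mxE.
split=> [[/is_derive_mxP /RE HR /is_derive_mxP /IE HI] i j|H].
  by split; [exact: HR|exact: HI].
by split; apply/is_derive_mxP; [apply/RE|apply/IE] => i j; have [] := H i j.
Qed.

Lemma cderive_unique m n (F : R -> 'M[C]_(m, n)) s X Y :
  cderive F s X -> cderive F s Y -> X = Y.
Proof.
move=> [XR XI] [YR YI].
have /matrixP ER := is_derive_unique XR YR; have /matrixP EI := is_derive_unique XI YI.
apply/matrixP => i j; have := ER i j; have := EI i j; rewrite !mxE.
by case: (X i j) => a b; case: (Y i j) => a' b' /= -> ->.
Qed.

Lemma cderive_cst m n (A : 'M[C]_(m, n)) s : cderive (fun=> A) s 0.
Proof. by split; rewrite (_ : map_mx _ 0 = 0) ?map_mx0//; exact: is_derive_cst. Qed.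

Lemma Re_mulmx m n p (A : 'M[C]_(m, n)) (B : 'M[C]_(n, p)) :
  Rem (A *m B) = Rem A *m Rem B - Imm A *m Imm B.
Proof.
apply/matrixP => i j; rewrite !mxE raddf_sum -sumrB; apply: eq_bigr => k _.
by rewrite !mxE; case: (A i k) => a b; case: (B k j).
Qed.

Lemma Im_mulmx m n p (A : 'M[C]_(m, n)) (B : 'M[C]_(n, p)) :
  Imm (A *m B) = Rem A *m Imm B + Imm A *m Rem B.
Proof.
apply/matrixP => i j; rewrite !mxE raddf_sum -big_split; apply: eq_bigr => k _.
by rewrite !mxE; case: (A i k) => a b; case: (B k j).
Qed.

Lemma cderive_mul m n p (F : R -> 'M[C]_(m, n)) (G : R -> 'M[C]_(n, p)) s X Y :
  cderive F s X -> cderive G s Y ->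
  cderive (fun t => F t *m G t) s (X *m G s + F s *m Y).
Proof.
move=> [XR XI] [YR YI]; split.
  under eq_fun do rewrite Re_mulmx.
  have /is_derive_eq := is_deriveB (is_derive_mulmx XR YR) (is_derive_mulmx XI YI); apply.
  by rewrite map_mxD !Re_mulmx opprD !addrA; congr (_ - _); rewrite -!addrA; congr (_ + _); rewrite addrC.
under eq_fun do rewrite Im_mulmx.
have /is_derive_eq := is_deriveD (is_derive_mulmx XR YI) (is_derive_mulmx XI YR); apply.
by rewrite map_mxD !Im_mulmx addrACA.
Qed.

Lemma cderive_mul_cst m n p q (A : 'M[C]_(m, n)) (F : R -> 'M[C]_(n, p))
    (B : 'M[C]_(p, q)) s X :
  cderive F s X -> cderive (fun t => A *m F t *m B) s (A *m X *m B).
Proof.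
move=> dF; have := cderive_mul (cderive_mul (cderive_cst A s) dF) (cderive_cst B s).
by rewrite mul0mx add0r mulmx0 addr0.
Qed.

Lemma cderive_adj m n (F : R -> 'M[C]_(m, n)) s X :
  cderive F s X -> cderive (fun t => adjmx (F t)) s (adjmx X).
Proof.
have RE (z : C) : complex.Re z^*%C = complex.Re z by case: z.
have IE (z : C) : complex.Im z^*%C = - complex.Im z by case: z.
move=> /cderiveP dF; apply/cderiveP => i j; have [dR dI] := dF j i.
rewrite !mxE RE IE; under eq_fun do rewrite !mxE RE.
split => //; under eq_fun do rewrite !mxE IE.
exact: is_deriveN.
Qed.

Lemma cderive_form n (u : R -> 'cV[C]_n) w (X : 'M[C]_n) s : cderive u s w ->
  cderive (fun t => adjmx (u t) *m X *m u t) s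
    (adjmx w *m X *m u s + adjmx (u s) *m X *m w).
Proof.
move=> du; have := cderive_mul (cderive_mul (cderive_adj du) (cderive_cst X s)) du.
by rewrite mulmx0 addr0.
Qed.

Lemma cderive_line m n (v w : 'M[C]_(m, n)) s : cderive (fun t : R => v + t%:C%C *: w) s w.
Proof.
have RE (a b : C) (t : R) : complex.Re (a + t%:C%C * b) = complex.Re a + t * complex.Re b.
  by case: a; case: b => /= *; rewrite mul0r subr0.
have IE (a b : C) (t : R) : complex.Im (a + t%:C%C * b) = complex.Im a + t * complex.Im b.
  by case: a; case: b => /= *; rewrite mul0r addr0.
apply/cderiveP => i j; under eq_fun do rewrite !mxE RE.
split; first exact: (is_derive_line (complex.Re (v i j) : R^o) (complex.Re (w i j))).
under eq_fun do rewrite !mxE IE.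
exact: (is_derive_line (complex.Im (v i j) : R^o) (complex.Im (w i j))).
Qed.

End ComplexCurves.

Section Representation.
Variables (R : realType) (d N : nat) (K : topologicalGroupType).
Variables (L : lieGroup R d K) (c : chart R d K).
Hypotheses (c_atlas : atlas L c) (c_one : cdom c 1%g).
Variable rho : K -> 'M[R[i]]_N.
Hypothesis rho_rep : unitary_representation L rho.

Local Notation p1 := (coord c 1%g).

Lemma rho_one : rho 1%g = 1%:M. Proof. by case: rho_rep. Qed.

Lemma rhoM g h : rho (g * h)%g = rho g *m rho h. Proof. by case: rho_rep. Qed.

Lemma rho_inv g : rho (g^-1)%g = adjmx (rho g).
Proof.
have [_ _ rhoU _] := rho_rep; have U := unitary_adj (rhoU g).
rewrite -[LHS]mulmx1 -U mulmxA -rhoM mulVg rho_one.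
exact: mul1mx.
Qed.

Lemma rho_param_diff j k :
  differentiable (fun y => complex.Re (rho (param c y) j k) : R^o) p1 /\
  differentiable (fun y => complex.Im (rho (param c y) j k) : R^o) p1.
Proof.
have [_ _ _ /(_ c c_atlas j k) [HR HI]] := rho_rep.
have [HR1 _] := HR 1%N; have [HI1 _] := HI 1%N.
by split; [apply: HR1|apply: HI1]; exists 1%g.
Qed.

(** [drho] computes the derivative of [rho] along every curve of velocity [x],
    not only along the straight line in the chart that defines it. *)
Lemma velocity_rho k x : velocity c k x -> cderive (rho \o k) 0 (drho c rho x).
Proof.
move=> kx; apply/cderiveP => i j; have [dR dI] := rho_param_diff i j.
rewrite !mxE /= !derive_dif//; split.
  exact: (velocity_fun (phi := fun g => complex.Re (rho g i j) : R^o) c_one dR kx).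
exact: (velocity_fun (phi := fun g => complex.Im (rho g i j) : R^o) c_one dI kx).
Qed.

Lemma drhoP (a : R) (x y : 'rV[R]_d) :
  drho c rho (a *: x + y) = a%:C%C *: drho c rho x + drho c rho y.
Proof.
apply/matrixP => i j; have [dR dI] := rho_param_diff i j.
rewrite !mxE !derive_dif// !difP.
move: (dif _ _ x) (dif _ _ y) (dif _ _ x) (dif _ _ y) => p q r t.
by apply/eqP; rewrite eq_complex /= mul0r subr0 mul0r addr0 !eqxx.
Qed.

(** This identity carries the equivariance of the momentum map. *)
Lemma drho_Ad g x : drho c rho (x *m Ad c g) = rho g *m drho c rho x *m rho g^-1%g.
Proof.
have kx := velocity_param c_one x; set k := (fun s => _) in kx.
apply: cderive_unique (velocity_rho (velocity_conj c_atlas c_one g kx)) _.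
have := cderive_mul_cst (rho g) (rho g^-1%g) (velocity_rho kx).
by congr (cderive _ _ _); apply/funext => s /=; rewrite !rhoM.
Qed.

(** Differentiate [rho g *m adjmx (rho g) = 1]. *)
Lemma drho_skew x : adjmx (drho c rho x) = - drho c rho x.
Proof.
have kx := velocity_param c_one x; set k := (fun s => _) in kx.
have [k0 _ _] := kx; have dk := velocity_rho kx.
have := cderive_mul dk (cderive_adj dk).
have -> : (fun s => (rho \o k) s *m adjmx ((rho \o k) s)) = fun=> 1%:M.
  by apply/funext => s; rewrite /= unitary_adj//; have [_ _ + _] := rho_rep; apply.
rewrite /= k0 rho_one => /cderive_unique /(_ (cderive_cst _ _)).
have -> : adjmx (1%:M : 'M[R[i]]_N) = 1%:M by rewrite /adjmx map_mx1 trmx1.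
by rewrite mulmx1 mul1mx addrC => /eqP; rewrite addr_eq0 => /eqP.
Qed.

Definition momentum (x : 'rV[R]_d) (v : 'cV[R[i]]_N) : R :=
  complex.Im ((adjmx v *m drho c rho x *m v) 0 0).
Definition sqnorm (v : 'cV[R[i]]_N) : R := complex.Re ((adjmx v *m v) 0 0).

Lemma sqnormE v : (adjmx v *m v) 0 0 = (sqnorm v)%:C%C.
Proof.
apply/eqP; rewrite eq_complex eqxx /= mxE raddf_sum; apply/eqP; apply: big1 => j _.
by rewrite !mxE; case: (v j 0) => a b /=; ring.
Qed.

Lemma sqnorm_gt0 v : v != 0 -> 0 < sqnorm v.
Proof.
move=> /eqP v0; rewrite /sqnorm mxE raddf_sum lt_def.
have ge0 j : 0 <= complex.Re (adjmx v 0 j * v j 0).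
  rewrite !mxE; case: (v j 0) => a b /=; rewrite mulNr opprK.
  by rewrite addr_ge0// -expr2 sqr_ge0.
rewrite (sumr_ge0 _ (fun j _ => ge0 j)) andbT; apply/eqP => H; apply: v0; apply/colP => j.
have /= := psumr_eq0P (fun j _ => ge0 j) H (i := j) isT.
rewrite !mxE; case: (v j 0) => a b /=; rewrite mulNr opprK -!expr2 => /eqP.
by rewrite paddr_eq0 ?sqr_ge0// !sqrf_eq0 => /andP[/eqP -> /eqP ->].
Qed.

(** [mu] is given by its values on the standard basis; linearity of [drho]
    extends the formula to all of the Lie algebra. *)
Lemma pairing_mu v x : pairing (mu c rho v) x = momentum x v / sqnorm v.
Proof.
pose l x : R := complex.Re (hermitian (drho c rho x *m v) v / ('i%C * hermitian v v)).
have lE y : l y = momentum y v / sqnorm v.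
  rewrite /l !hermitianE sqnormE mulmxA /momentum; move: (sqnorm v) => n.
  have -> : ('i * n%:C)^-1%C = (n^-1)%:C%C * - 'i%C.
    by rewrite invfM mulrC fmorphV invCi.
  case: (_ 0 0) => a b /=; ring.
have -> : mu c rho v = \row_j l (delta_mx 0 j) by [].
rewrite linear_pairing ?lE// => a y z; rewrite !lE /momentum drhoP.
move: (drho c rho y) (drho c rho z) => A B.
rewrite mulmxDr mulmxDl -scalemxAr -scalemxAl !mxE.
case: (\sum_(_ < _) _) (\sum_(_ < _) _) => p q [r t] /=; ring.
Qed.

End Representation.

Section Weights.
Variables (R : realType) (d N : nat) (K : topologicalGroupType).
Variables (L : lieGroup R d K) (c : chart R d K).
Hypotheses (c_atlas : atlas L c) (c_one : cdom c 1%g).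
Hypothesis K_compact : compact [set: K].
Hypothesis K_semisimple : semisimple c.
Variable T : set K.
Hypothesis T_max : maximal_torus T.
Variable rho : K -> 'M[R[i]]_N.
Hypothesis rho_rep : unitary_representation L rho.

Local Notation imag r := (Complex 0 r).

(** Differentiate [rho (k s) v = chi (k s) v] at 0. *)
Lemma drho_weight (chi : K -> R[i]) lambda (v : 'cV[R[i]]_N) k x :
  (forall g, T g -> rho g *m v = chi g *: v) -> differential_of c T chi lambda ->
  one_parameter c T k x -> drho c rho x *m v = imag (pairing lambda x) *: v.
Proof.
move=> vchi [_ dchi] kx; have [dR dI] := dchi k x kx; have [_ _ kT _] := kx.
have dk := velocity_rho c_atlas c_one rho_rep (one_parameter_velocity kx).
have := cderive_mul dk (cderive_cst v 0); rewrite mulmx0 addr0.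
move=> /cderive_unique; apply.
have dchik : cderive (fun s => (chi (k s))%:M : 'M[R[i]]_1) 0 ((imag (pairing lambda x))%:M).
  apply/cderiveP => i j; rewrite !ord1 !mxE eqxx mulr1n /=.
  by split; under eq_fun do rewrite mxE eqxx mulr1n.
have := cderive_mul (cderive_cst v 0) dchik.
rewrite mul0mx add0r mul_mx_scalar; congr (cderive _ _ _); apply/funext => s.
by rewrite mul_mx_scalar vchi.
Qed.

Lemma weight_unit_vector lambda : weights c T rho lambda ->
  exists v : 'cV[R[i]]_N, adjmx v *m v = 1%:M /\
    forall x, torus_lie c T x -> drho c rho x *m v = imag (pairing lambda x) *: v.
Proof.
move=> [chi [v v0 vchi] dchi]; have n0 := sqnorm_gt0 v0.
exists ((Num.sqrt (sqnorm v))^-1%:C%C *: v); split.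
  rewrite adjmxZ conjc_real -scalemxAl -scalemxAr scalerA.
  apply/matrixP => i j; rewrite !ord1 [RHS]mxE eqxx mxE sqnormE -!rmorphM /=.
  by rewrite -invfM -expr2 sqr_sqrtr ?ltW// mulVf// gt_eqF.
by move=> x [k kx]; rewrite -scalemxAr (drho_weight vchi dchi kx) !scalerA mulrC.
Qed.

(** Two distinct weights differ on some element of the torus, whose skew
    differential then has orthogonal eigenvectors. *)
Lemma weight_vectors_orthogonal lambda lambda' (u v : 'cV[R[i]]_N) :
  weights c T rho lambda -> weights c T rho lambda' -> lambda != lambda' ->
  (forall x, torus_lie c T x -> drho c rho x *m u = imag (pairing lambda x) *: u) ->
  (forall x, torus_lie c T x -> drho c rho x *m v = imag (pairing lambda' x) *: v) ->
  adjmx v *m u = 0.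
Proof.
move=> [chi _ [[y yT yl] _]] [chi' _ [[y' y'T y'l] _]] ll' ux vx.
have xT : torus_lie c T (y - y').
  by rewrite -scaleN1r addrC; exact (torus_lieP c_atlas c_one T_max (-1) y'T yT).
have := vx _ xT; have := ux _ xT.
have : pairing lambda (y - y') != pairing lambda' (y - y').
  rewrite -yl -y'l !(pairing_flat c_atlas c_one) -subr_eq0.
  have [_ pos] := kform_ge0 c_atlas c_one K_compact K_semisimple (y - y').
  apply: contraNneq ll' => E; rewrite -yl -y'l.
  suff -> : y = y' by [].
  apply/eqP; rewrite -subr_eq0; apply/eqP/pos.
  have := kformPl c_atlas c_one (-1) y' y (y - y').
  by rewrite scaleN1r addrC => ->; rewrite mulN1r addrC.
have := drho_skew c_atlas c_one rho_rep (y - y').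
move: (drho c rho _) (pairing lambda _) (pairing lambda' _) => X a b Xskew ab uX vX.
have vX' : adjmx v *m X = imag b *: adjmx v.
  rewrite -[X]adjmxK Xskew -adjmx_mul mulNmx vX -scaleNr adjmxZ; congr (_ *: _).
  by apply/eqP; rewrite eq_complex /= oppr0 opprK !eqxx.
apply/eqP; have : (imag a - imag b) *: (adjmx v *m u) == 0.
  by rewrite scalerBl scalemxAr -uX mulmxA vX' -scalemxAl subrr.
by rewrite scaler_eq0 subr_eq0 eq_complex /= (negPf ab) andbF.
Qed.

Lemma weight_frame m (p : 'I_m -> 'rV[R]_d) : injective p ->
  (forall j, weights c T rho (p j)) ->
  exists E : 'M[R[i]]_(N, m), adjmx E *m E = 1%:M /\ forall x, torus_lie c T x ->
    drho c rho x *m E = E *m diag_mx (\row_j imag (pairing (p j) x)).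
Proof.
move=> pI pw.
have [e eP] := choice (fun j => weight_unit_vector (pw j)).
pose E := \matrix_(i, j) e j i 0.
have Ecol j : col j E = e j by apply/colP => i; rewrite !mxE.
exists E; split.
  apply/matrixP => i j.
  have -> : (adjmx E *m E) i j = (adjmx (e i) *m e j) 0 0.
    by rewrite !mxE; apply: eq_bigr => k _; rewrite !mxE.
  rewrite [RHS]mxE; have [->|ij] := eqVneq i j.
    by have [-> _] := eP j; rewrite mxE.
  rewrite (weight_vectors_orthogonal (pw j) (pw i)) ?mxE//.
  - by apply: contra ij => /eqP /pI ->.
  - by have [] := eP j.
  - by have [] := eP i.
move=> x xT; apply/matrixP => i j; have [_ /(_ x xT) /colP /(_ i)] := eP j.
have -> : (drho c rho x *m e j) i 0 = (drho c rho x *m E) i j.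
  by rewrite [LHS]mxE [RHS]mxE; apply: eq_bigr => k _; rewrite [E k j]mxE.
move=> ->; rewrite mul_mx_diag [LHS]mxE [RHS]mxE [E i j]mxE [X in _ = _ * X]mxE.
exact: mulrC.
Qed.

End Weights.

(** * The closest point of a convex hull *)

(** Adding up the coefficients of equal points makes them distinct, so that
    weight vectors attached to them are orthogonal. *)
Lemma convex_hull_injective (R : realType) d (M : set 'rV[R]_d) x : convex_hull M x ->
  exists m (p : 'I_m -> 'rV[R]_d) (a : 'I_m -> R),
    [/\ injective p, forall j, M (p j), forall j, 0 <= a j, \sum_j a j = 1
      & x = \sum_j a j *: p j].
Proof.
move=> [m [p [a [pM a0 a1 xE]]]]; pose s := undup [seq p j | j <- enum 'I_m].
have sE u : (u \in s) = (u \in codom p) by rewrite mem_undup.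
pose b u := \sum_(j | p j == u) a j.
have bE (W : lmodType R) (F : 'rV[R]_d -> W) :
    \sum_j a j *: F (p j) = \sum_(j < size s) b (nth 0 s j) *: F (nth 0 s j).
  rewrite -(big_mkord xpredT (fun j => b (nth 0 s j) *: F (nth 0 s j))).
  rewrite -(big_nth 0 xpredT (fun u => b u *: F u)).
  rewrite (eq_bigr (fun j => \sum_(u <- s) if p j == u then a j *: F u else 0)).
    rewrite exchange_big /=; apply: eq_bigr => u _.
    by rewrite -big_mkcond scaler_suml.
  move=> j _; rewrite (bigD1_seq (p j)) ?undup_uniq ?sE ?codom_f//= eqxx.
  by rewrite big1 ?addr0// => u /negPf; rewrite eq_sym => ->.
exists (size s), (fun j => nth 0 s j), (fun j => b (nth 0 s j)); split.
- move=> i j /eqP; rewrite nth_uniq ?undup_uniq// => /eqP ij; exact: val_inj.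
- by move=> j; have := mem_nth 0 (ltn_ord j); rewrite sE => /codomP[k ->].
- by move=> j; apply: sumr_ge0.
- have := bE R^o (fun=> 1); rewrite /GRing.scale /=.
  by under eq_bigr do rewrite mulr1; under [in RHS]eq_bigr do rewrite mulr1; rewrite a1.
- by rewrite xE (bE _ id).
Qed.

Section ClosestPoint.
Variables (R : realType) (d : nat) (K : topologicalGroupType).
Variables (L : lieGroup R d K) (c : chart R d K).
Hypotheses (c_atlas : atlas L c) (c_one : cdom c 1%g).
Hypothesis K_compact : compact [set: K].
Hypothesis K_semisimple : semisimple c.

(** First-order optimality: moving from [xi] towards [p k] cannot decrease the
    norm, so [dual_form xi (p k - xi)] is nonnegative, while these numbers
    average to zero with the weights [a]. *)
Lemma closest_support (M : set 'rV[R]_d) xi m (p : 'I_m -> 'rV[R]_d) (a : 'I_m -> R) :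
  closest_to_origin c M xi -> (forall j, M (p j)) -> (forall j, 0 <= a j) ->
  \sum_j a j = 1 -> xi = \sum_j a j *: p j ->
  forall k, a k != 0 -> dual_form c xi (p k) = normsq c xi.
Proof.
move=> [_ closest] pM a0 a1 xiE.
have Bsum k (b : 'I_m -> R) : dual_form c k (\sum_j b j *: p j) = \sum_j b j * dual_form c k (p j).
  rewrite /dual_form /sharp mulmx_suml; under eq_bigr do rewrite -scalemxAl.
  exact: (kform_sumr c_atlas c_one).
have BC := kformC c; have BP := kformPl c_atlas c_one.
have B0 x := (kform_ge0 c_atlas c_one K_compact K_semisimple x).1.
have {}BP e x y z : dual_form c (e *: x + y) z = e * dual_form c x z + dual_form c y z.
  by rewrite /dual_form /sharp mulmxDl -scalemxAl; exact: BP.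
have {}BC x y : dual_form c x y = dual_form c y x by exact: BC.
have {}B0 x : 0 <= dual_form c x x by exact: B0.
rewrite /normsq in closest *; move: (dual_form c) BC BP B0 Bsum closest => B BC BP B0 Bsum closest.
have grow k : B xi xi <= B xi (p k).
  rewrite leNgt; apply/negP => lt.
  pose v := p k - xi.
  have vE : v = -1 *: xi + p k by rewrite scaleN1r addrC.
  have Bv : B v xi = B xi (p k) - B xi xi by rewrite vE BP (BC (p k)); ring.
  (* Small enough for the linear term to dominate the quadratic one. *)
  pose t := - B v xi / (B v v - B v xi).
  have den : 0 < B v v - B v xi by have := B0 v; rewrite Bv; lra.
  have t0 : 0 < t by rewrite divr_gt0// Bv; lra.
  have t1 : t <= 1 by rewrite ler_pdivrMr// mul1r; have := B0 v; lra.
  have tE : t * (B v v - B v xi) = - B v xi by rewrite divfK// gt_eqF.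
  have hull : convex_hull M (t *: v + xi).
    exists m, p, (fun j => (1 - t) * a j + t * (j == k)%:R); split => //.
    - by move=> j; rewrite addr_ge0// mulr_ge0// ?ler0n ?subr_ge0// ltW.
    - rewrite big_split /= -!mulr_sumr a1 (bigD1 k)//= eqxx big1 => [|j /negPf ->//].
      by rewrite addr0 !mulr1 subrK.
    - have -> : \sum_j ((1 - t) * a j + t * (j == k)%:R) *: p j = (1 - t) *: xi + t *: p k.
        rewrite (eq_bigr (fun j => (1 - t) *: (a j *: p j) + t *: ((j == k)%:R *: p j))).
          rewrite big_split /= -!scaler_sumr -xiE; congr (_ + _ *: _).
          rewrite (bigD1 k)//= eqxx scale1r big1 ?addr0// => j /negPf ->.
          by rewrite scale0r.
        by move=> j _; rewrite scalerDl !scalerA.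
      by rewrite /v scalerBr scalerBl scale1r [RHS]addrC addrA addrAC.
  have := closest _ hull.
  have -> : B (t *: v + xi) (t *: v + xi) = t ^+ 2 * B v v + 2 * t * B v xi + B xi xi.
    by rewrite BP (BC v) (BC xi (_ + _)) !BP (BC xi v); ring.
  have : B v xi < 0 by rewrite Bv; lra.
  have := tE; have := t0; move: (t) (B v v) (B v xi) => e x y; nra.
have sum0 : \sum_j a j * (B xi (p j) - B xi xi) = 0.
  under eq_bigr do rewrite mulrBr.
  by rewrite sumrB -Bsum -mulr_suml -xiE a1 mul1r subrr.
have ge0 j : true -> 0 <= a j * (B xi (p j) - B xi xi).
  by rewrite mulr_ge0 ?subr_ge0.
move=> k ak; have /eqP := psumr_eq0P ge0 sum0 (i := k) isT.
by rewrite mulf_eq0 (negPf ak) /= subr_eq0 => /eqP.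
Qed.

End ClosestPoint.

(** * Eigenvectors of an element of the Lie algebra *)

Section Eigenvector.
Variables (R : realType) (d N : nat) (K : topologicalGroupType).
Variables (L : lieGroup R d K) (c : chart R d K).
Hypotheses (c_atlas : atlas L c) (c_one : cdom c 1%g).
Hypothesis K_semisimple : semisimple c.
Variable rho : K -> 'M[R[i]]_N.
Hypothesis rho_rep : unitary_representation L rho.

Local Opaque Ad.

Local Notation imag r := (Complex 0 r).

Variables (v : 'cV[R[i]]_N) (x0 : 'rV[R]_d) (kappa : R).
Hypotheses (v0 : v != 0) (vx0 : drho c rho x0 *m v = imag kappa *: v).

(** [drho x0] is skew and its eigenvalue on [v] imaginary. *)
Lemma adj_eigen : adjmx v *m drho c rho x0 = imag kappa *: adjmx v.
Proof.
rewrite -[drho c rho x0]adjmxK (drho_skew c_atlas c_one rho_rep) -adjmx_mul.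
rewrite mulNmx vx0 -scaleNr adjmxZ; congr (_ *: _).
by apply/eqP; rewrite eq_complex /= oppr0 opprK !eqxx.
Qed.

(** The point [v] of the projective space is fixed by the one-parameter group
    of [x0], so its momentum is fixed too, by equivariance. Infinitesimally,
    [<[drho x0, drho x] v, v> = 0] for all [x]. *)
Lemma momentum_fixed (T : set K) k s : one_parameter c T k x0 ->
  sharp c (mu c rho v) *m Ad c (k s) = sharp c (mu c rho v).
Proof.
move=> kx; have [_ kD _ _] := kx.
have k0 := one_parameter0 kx; have vk := one_parameter_velocity kx.
have dmom x : is_derive (0 : R^o) (1 : R^o)
    (fun s => momentum c rho (x *m Ad c (k s)) v : R^o) 0.
  have dk := velocity_rho c_atlas c_one rho_rep vk.
  have dkV : cderive (fun s => rho (k s)^-1%g) 0 (- drho c rho x0).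
    rewrite -(drho_skew c_atlas c_one rho_rep); under eq_fun do rewrite (rho_inv rho_rep).
    exact: cderive_adj dk.
  have := cderive_mul (cderive_mul_cst (adjmx v) (drho c rho x) dk)
    (cderive_mul dkV (cderive_cst v 0)).
  rewrite /= k0 invg1 (rho_one rho_rep) !mulmx0 addr0 mulmx1 mul1mx adj_eigen.
  rewrite mulNmx vx0 mulmxN -scalemxAr -!scalemxAl subrr.
  move=> /cderiveP /(_ 0 0)[_]; rewrite mxE /=.
  congr (is_derive _ _ _ _); apply/funext => s'.
  by rewrite /momentum (drho_Ad c_atlas c_one rho_rep) !mulmxA.
have cst (f : R -> R) : (forall u, is_derive (0 : R^o) (1 : R^o) (fun h => f (u + h) : R^o) 0) ->
    forall u, f u = f 0.
  by move=> df u; apply: is_derive_0_is_cst => t; apply: is_derive_shift0.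
have mom x : momentum c rho (x *m Ad c (k s)) v = momentum c rho x v.
  have x1 : x *m Ad c (k 0) = x by rewrite k0 (Ad_one c_atlas c_one) mulmx1.
  have shift u : (fun h => momentum c rho (x *m Ad c (k (u + h))) v : R^o) =
      (fun h => momentum c rho (x *m Ad c (k u) *m Ad c (k h)) v : R^o).
    apply/funext => h; rewrite addrC kD (Ad_mul c_atlas c_one).
    by move: (Ad c (k h)) => B; rewrite mulmxA.
  have dm u : is_derive (0 : R^o) (1 : R^o)
      (fun h => momentum c rho (x *m Ad c (k (u + h))) v : R^o) 0.
    by rewrite shift; exact (dmom (x *m Ad c (k u))).
  have E := cst (fun s => momentum c rho (x *m Ad c (k s)) v) dm s.
  exact (etrans E (congr1 (fun y => momentum c rho y v) x1)).
have pairE y : kform c (sharp c (mu c rho v)) y = momentum c rho y v / sqnorm v.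
  by rewrite (kform_sharp c_atlas c_one K_semisimple) (pairing_mu c_atlas c_one rho_rep).
have fixed x : kform c (sharp c (mu c rho v) *m Ad c (k s)) x = kform c (sharp c (mu c rho v)) x.
  have yx : x *m Ad c (k s)^-1%g *m Ad c (k s) = x.
    by rewrite -mulmxA (Ad_invl c_atlas c_one) mulmx1.
  have E1 := kform_Ad c_atlas c_one (k s) (sharp c (mu c rho v)) (x *m Ad c (k s)^-1%g).
  have E2 := mom (x *m Ad c (k s)^-1%g).
  move: yx E1 E2; move: (Ad c (k s)) (x *m Ad c (k s)^-1%g) => B y yx.
  by rewrite yx => -> E2; rewrite !pairE E2.
have kform_inj y z : (forall x, kform c y x = kform c z x) -> y = z.
  move=> yz; rewrite -(flatK c_atlas c_one K_semisimple y) -(flatK c_atlas c_one K_semisimple z).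
  by congr (sharp c _); apply: pairing_inj => x; rewrite !(pairing_flat c_atlas c_one).
exact (kform_inj _ _ fixed).
Qed.

(** Both [momentum x] and [sqnorm] are real quadratic forms; on [v] the
    polar form of [momentum x0] is [kappa] times that of [sqnorm], whence the
    vanishing derivative of the quotient. *)
Lemma mu_line_derive (w : 'cV[R[i]]_N) : exists2 m,
  is_derive (0 : R^o) (1 : R^o) (fun s : R => mu c rho (v + s%:C%C *: w)) m
  & pairing m x0 = 0.
Proof.
pose u (s : R) := v + s%:C%C *: w.
have u0 : u 0 = v by rewrite /u scale0r addr0.
have du : cderive u 0 w := cderive_line v w 0.
pose b x := complex.Im ((adjmx w *m drho c rho x *m v + adjmx v *m drho c rho x *m w) 0 0).
pose b1 := complex.Re ((adjmx w *m v + adjmx v *m w) 0 0).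
have dmom x : is_derive (0 : R^o) (1 : R^o) (fun s => momentum c rho x (u s) : R^o) (b x).
  have /cderiveP /(_ 0 0)[_] := cderive_form (drho c rho x) du.
  by rewrite u0.
have dnorm : is_derive (0 : R^o) (1 : R^o) (fun s => sqnorm (u s) : R^o) b1.
  by have := cderive_mul (cderive_adj du) du; rewrite u0 => /cderiveP /(_ 0 0)[].
have n0 := sqnorm_gt0 v0.
pose D x := momentum c rho x v * (- (sqnorm v ^- 2) * b1) + (sqnorm v)^-1 * b x.
have dq x : is_derive (0 : R^o) (1 : R^o) (fun s => pairing (mu c rho (u s)) x : R^o) (D x).
  under eq_fun do rewrite (pairing_mu c_atlas c_one rho_rep).
  have un0 : sqnorm (u 0) != 0 by rewrite u0 gt_eqF.
  have := is_deriveM (dmom x) (is_deriveV un0 dnorm).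
  by rewrite u0.
exists (\row_j D (delta_mx 0 j)).
  apply/is_derive_mxP => i j; rewrite mxE ord1.
  have := dq (delta_mx 0 j); congr (is_derive _ _ _ _); apply/funext => s.
  by rewrite pairingE trmx_delta -colE mxE.
have -> : pairing (\row_j D (delta_mx 0 j)) x0 = D x0.
  apply: linear_pairing => a x y; rewrite /D /b /momentum (drhoP c_atlas c_one rho_rep).
  move: (drho c rho x) (drho c rho y) (adjmx v) (adjmx w) => X Y v' w'.
  rewrite !(mulmxDr, mulmxDl) -!(scalemxAl, scalemxAr) !mxE.
  do 6![case: (\sum_(_ < _) _) => ? ?] => /=; ring.
rewrite /D /b /b1 /momentum adj_eigen -!scalemxAl -(mulmxA _ _ v) vx0 -scalemxAr -scalerDr.
move: (adjmx w *m v + adjmx v *m w) => B.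
rewrite [(imag kappa *: B) 0 0]mxE [(_ *: (_ *m v)) 0 0]mxE.
have imE (z : R[i]) : complex.Im (imag kappa * z) = kappa * complex.Re z.
  by case: z => p q /=; ring.
rewrite !imE -/(sqnorm v); field; exact: lt0r_neq0.
Qed.

Lemma normsq_pairing (f : 'rV[R]_d) : normsq c f = (f *m (sharp c f)^T) 0 0.
Proof.
by rewrite /normsq /dual_form (kformE c_atlas c_one) -/(flat c _) (sharpK c_atlas c_one).
Qed.

(** The derivative of [normsq (mu u)] is twice the derivative of [mu u] paired
    with [sharp (mu v) = x0]. *)
Lemma eigen_critical : sharp c (mu c rho v) = x0 -> critical c rho v.
Proof.
move=> mux0 w; have [m dm mx0] := mu_line_derive w.
under eq_fun do rewrite normsq_pairing.
have dsharp : is_derive (0 : R^o) (1 : R^o)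
    (fun s : R => (sharp c (mu c rho (v + s%:C%C *: w)))^T) (sharp c m)^T.
  apply/is_derive_mxP => i j; rewrite mxE; under eq_fun do rewrite mxE.
  have := is_derive_mulmx_cst 1%:M (invmx (kgram c)) dm.
  by rewrite mul1mx => /is_derive_mxP /(_ j i); under eq_fun do rewrite mul1mx.
have := is_derive_mulmx dm dsharp => /is_derive_mxP /(_ 0 0).
rewrite scale0r addr0 mux0 mxE -!pairingE mx0 add0r.
have -> : pairing (mu c rho v) (sharp c m) = 0; last exact.
rewrite -(kform_sharp c_atlas c_one K_semisimple) kformC.
by rewrite (kform_sharp c_atlas c_one K_semisimple) mux0.
Qed.

End Eigenvector.

(** * Regular values of the momentum map *)

Theorem proposition4p7 (R : realType) (d N : nat)
  (K : topologicalGroupType) (L : lieGroup R d K)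
  (c : chart R d K) (c_atlas : atlas L c) (c_one : cdom c 1%g)
  (K_compact : compact [set: K]) (K_connected : connected [set: K])
  (K_semisimple : semisimple c)
  (T : set K) (T_max : maximal_torus T)
  (rho : K -> 'M[R[i]]_N) (rho_rep : unitary_representation L rho)
  (xi : 'rV[R]_d) (xi_Xi : Xi c rho T xi) (xi_regular : regular c T xi) :
  intermediate_critical_value c rho xi.
Proof.
have [M [Mw _ closest]] := xi_Xi; have [hull _] := closest.
have [m [p [a [pI pM a0 a1 xiE]]]] := convex_hull_injective hull.
have pw j : weights c T rho (p j) := Mw _ (pM j).
have support := closest_support c_atlas c_one K_compact K_semisimple closest pM a0 a1 xiE.
have [E [EE Ex]] := weight_frame c_atlas c_one K_compact K_semisimple T_max rho_rep pI pw.
pose x0 := sharp c xi; pose kappa := normsq c xi.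
have x0xi : flat c x0 = xi := sharpK c_atlas c_one K_semisimple xi.
have x0E : x0 = \sum_j a j *: sharp c (p j).
  by rewrite /x0 xiE /sharp mulmx_suml; apply: eq_bigr => j _; rewrite scalemxAl.
have x0T : torus_lie c T x0.
  rewrite x0E; apply: big_rec => [|j x _ xT]; first exact: torus_lie0 T_max.
  apply: (torus_lieP c_atlas c_one T_max) xT.
  have [chi _ [[y yT <-] _]] := pw j.
  by rewrite (flatK c_atlas c_one K_semisimple).
have [k kx] := x0T.
have px0 j : pairing (p j) x0 = dual_form c xi (p j).
  by rewrite /dual_form kformC (kform_sharp c_atlas c_one K_semisimple).
(* Orthonormal weight vectors turn squared coordinates into the coefficients of
   a convex combination of the weights: the momentum of [v] restricts to [xi]
   on the torus. *)
pose u : 'cV[R[i]]_m := \col_j (Num.sqrt (a j))%:C%C; pose v := E *m u.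
(* The weights that occur in [v] all take the value [kappa] on [x0]. *)
have vx0 : drho c rho x0 *m v = Complex 0 kappa *: v.
  rewrite mulmxA (Ex _ x0T) -mulmxA scalemxAr; congr (_ *m _).
  apply/colP => j; rewrite mul_diag_mx !mxE.
  have [->|aj] := eqVneq (a j) 0; first by rewrite sqrtr0 !mulr0.
  by rewrite px0 support.
have vform x : torus_lie c T x ->
    (adjmx v *m drho c rho x *m v) 0 0 = Complex 0 (pairing xi x).
  move=> xT; rewrite -mulmxA (mulmxA _ E) (Ex _ xT) adjmx_mul !mulmxA.
  rewrite -(mulmxA _ _ E) EE mulmx1 -mulmxA mxE.
  under eq_bigr do rewrite mul_diag_mx !mxE conjc_real mulrCA -rmorphM /= -expr2 sqr_sqrtr//.
  have -> : pairing xi x = \sum_j a j * pairing (p j) x.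
    rewrite pairingE xiE mulmx_suml summxE; apply: eq_bigr => j _.
    by rewrite -scalemxAl mxE pairingE.
  apply/eqP; rewrite eq_complex /= !raddf_sum /=; apply/andP; split.
    by rewrite big1// => j _; rewrite mul0r mulr0 subr0.
  by apply/eqP; apply: eq_bigr => j _; rewrite mul0r add0r mulrC.
have vnorm : (adjmx v *m v) 0 0 = 1.
  rewrite adjmx_mul mulmxA -(mulmxA _ _ E) EE mulmx1 mxE.
  under eq_bigr do rewrite !mxE conjc_real -rmorphM /= -expr2 sqr_sqrtr//.
  by rewrite -rmorph_sum a1.
have v0 : v != 0.
  by apply: contra_eq_neq vnorm => ->; rewrite mulmx0 mxE eq_sym oner_neq0.
pose nu := sharp c (mu c rho v).
have nu_torus x : torus_lie c T x -> kform c nu x = kform c x0 x.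
  move=> xT; rewrite !(kform_sharp c_atlas c_one K_semisimple).
  rewrite (pairing_mu c_atlas c_one rho_rep) /momentum (vform _ xT) /sqnorm vnorm.
  exact: divr1.
(* The momentum of [v] commutes with [x0]; as [x0] is regular, it lies in the
   Lie algebra of [T], where it is known to be [x0]. *)
have nuT : torus_lie c T nu.
  apply: (torus_lie_centralizer c_atlas c_one K_compact T_max).
  apply: (regular_fixed c_atlas c_one K_compact K_semisimple T_max kx); first by rewrite x0xi.
  by move=> s; exact (momentum_fixed c_atlas c_one K_semisimple rho_rep vx0 s kx).
have nux0 : nu = x0.
  have zT := torus_lieP c_atlas c_one T_max (-1) x0T nuT.
  have [_ z0] := kform_ge0 c_atlas c_one K_compact K_semisimple (-1 *: x0 + nu).
  have := z0 _; rewrite (kformPl c_atlas c_one) (nu_torus _ zT) mulN1r addNr.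
  by rewrite scaleN1r addrC => /(_ erefl) /eqP; rewrite subr_eq0 => /eqP.
exists v; split => //.
  by rewrite -x0xi -nux0 /nu (sharpK c_atlas c_one K_semisimple).
exact: (eigen_critical c_atlas c_one K_semisimple rho_rep v0 vx0 nux0).
Qed.
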